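(* Let $2\le k\le t$ be fixed integers. There exists $m_0$ such that for all $m\ge m_0$: if $G$ is a $K_{k+1,t+1}^+$-free graph with $m$ edges, then $\lambda(G)\le\lambda(S_{k,m})$, with equality if and only if $G=S_{k,m}$.
   Context: All graphs are finite and simple; isolated vertices are ignored. $K_{k+1,t+1}^+$ is the graph obtained from the complete bipartite graph $K_{k+1,t+1}$ by adding one edge inside the part of size $k+1$. Split graph: for $1\le k<m$, write $m-\binom{k}{2}=kt'+r$ with integers $t'\ge 1$ and $0\le r\le k-1$; $S_{k,m}$ is the $m$-edge graph obtained from $K_k\vee t'K_1$ (a clique $K_k$ joined to $t'$ independent vertices) by adding one extra vertex adjacent to exactly $r$ vertices of the $K_k$. $\lambda(G)$ is the spectral radius of the adjacency matrix; $F$-free means no subgraph isomorphic to $F$. *)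

(* Defs.v *)
From HB Require Import structures.
From mathcomp Require Import all_boot all_order all_algebra.
From mathcomp Require Import boolp classical_sets reals.
Set Implicit Arguments. Unset Strict Implicit. Unset Printing Implicit Defensive.
Import Order.TTheory GRing.Theory Num.Theory.

Definition simple_graph (V : finType) (e : rel V) : Prop :=
  symmetric e /\ irreflexive e.

Definition edges (V : finType) (e : rel V) : {set {set V}} :=
  [set E : {set V} | [exists x, [exists y, e x y && (E == [set x; y])]]].

Definition nonisol (V : finType) (e : rel V) : {set V} :=
  [set x | [exists y, e x y]].

Definition has_subgraph (W V : finType) (f : rel W) (e : rel V) : Prop :=
  exists phi : W -> V, injective phi /\ forall a b, f a b -> e (phi a) (phi b).

Definition F_free (W V : finType) (f : rel W) (e : rel V) : Prop :=
  ~ has_subgraph f e.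

(* Equality of graphs, isolated vertices being ignored: an isomorphism between
   the subgraphs induced on the non-isolated vertices. *)
Definition same_graph (V W : finType) (e : rel V) (e' : rel W) : Prop :=
  exists phi : V -> W,
    {in nonisol e &, injective phi} /\
    phi @: nonisol e = nonisol e' /\
    {in nonisol e &, forall x y, e' (phi x) (phi y) = e x y}.

Definition adjmx (R : realType) (V : finType) (e : rel V) : 'M[R]_#|V| :=
  \matrix_(i, j) ((e (enum_val i) (enum_val j))%:R)%R.

(* Spectral radius: the largest modulus of an eigenvalue of the adjacency
   matrix (adjacency matrices of simple graphs are real symmetric, so all
   eigenvalues are real). *)
Definition spec_rad (R : realType) (V : finType) (e : rel V) : R :=
  sup [set `|a|%R | a in [set a : R | eigenvalue (adjmx R e) a]%classic]%classic.

Definition Kplus_rel (k t : nat) (x y : 'I_k.+1 + 'I_t.+1) : bool :=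
  match x, y with
  | inl a, inr _ => true
  | inr _, inl b => true
  | inl a, inl b => ((val a == 0) && (val b == 1)) || ((val a == 1) && (val b == 0))
  | inr _, inr _ => false
  end.

(* S_{k,m}: write m - C(k,2) = k t' + r with 0 <= r <= k-1;
   K_k (inl (inl _)) joined to t' independent vertices (inl (inr _)),
   plus an extra vertex (inr tt) adjacent to the first r clique vertices. *)
Definition S_t' (k m : nat) : nat := (m - 'C(k, 2)) %/ k.
Definition S_r (k m : nat) : nat := (m - 'C(k, 2)) %% k.

Definition S_vert (k m : nat) : finType := (('I_k + 'I_(S_t' k m)) + unit)%type.

Definition S_rel (k m : nat) (x y : S_vert k m) : bool :=
  match x, y with
  | inl (inl a), inl (inl b) => a != b
  | inl (inl _), inl (inr _) => true
  | inl (inr _), inl (inl _) => true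
  | inl (inr _), inl (inr _) => false
  | inl (inl a), inr _ => val a < S_r k m
  | inr _, inl (inl b) => val b < S_r k m
  | _, _ => false
  end.

(* Main.v *)
(* Let x be the unit Perron vector of G, write l for the spectral radius and
   weigh the vertices by y = x^2. If l(G) >= l(S_{k,m}), then
   l^2 - (k-1) l >= m - k^2.

   Cleaning. Choose the induced subgraph G' maximising l^2 - (29/30) |E|. In G'
   every vertex satisfies d(v) <~ 2 l^2 y_v, and l^2 y_v <= d(v) y(N(v)) by
   Cauchy-Schwarz, so every neighbourhood has weight about 1/2. If no single
   weight exceeds a constant, a weighted Kovari-Sos-Turan argument shows that
   adjacent vertices have negligible common neighbourhood; then G' is bipartite
   and l^2 <= m, a contradiction.

   Atoms. If some weight is bounded below, counting two-walks from heavy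
   vertices produces a bounded set A, completely joined to a set B with
   |A||B| ~ m, on which x is almost constant and maximal, x being small elsewhere.
   Restricting the eigenvalue equation to A gives
   l^2 y(A) <= l x_A^T Adj(A) x_A + m y(A), whence |A| = k and A is a clique:
   for |A| > k the forbidden graph makes A independent, and otherwise a
   non-clique loses a term linear in l. Applied to G' this shows that only
   boundedly many edges were deleted, so that G itself has an atom.

   Exact structure. Transplanting x to S_{k,m} and comparing Rayleigh quotients
   turns l(S_{k,m}) <= l(G) into an inequality between the sums of the squared
   weights received from A by the outer vertices. It is decided by the strict
   convexity of j |-> j^2: no edge lies outside A, and at most one outer vertex
   is joined to a proper nonempty part of A. *)

Require Import Defs.
From HB Require Import structures.
From mathcomp Require Import all_boot all_order all_algebra.
From mathcomp Require Import boolp classical_sets reals.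
From mathcomp Require Import topology normedtype derive ring lra zify.
(* Imported again: classical_sets shadows names such as subsetP and inE. *)
From mathcomp Require Import fintype finset.
Set Implicit Arguments. Unset Strict Implicit. Unset Printing Implicit Defensive.
Import Order.TTheory GRing.Theory Num.Theory.
Import numFieldNormedType.Exports.
Local Open Scope ring_scope.

(** * Rayleigh quotients and the Perron vector *)

Definition quad (R : realType) (V : finType) (e : rel V) (x : V -> R) : R :=
  \sum_v \sum_(w | e v w) x v * x w.

Lemma quad_abs_le (R : realType) (V : finType) (e : rel V) (x : V -> R) :
  `|quad e x| <= quad e (fun v => `|x v|).
Proof.
apply: le_trans (ler_norm_sum _ _ _) _; apply: ler_sum => v _.
apply: le_trans (ler_norm_sum _ _ _) _; apply: ler_sum => w _.
by rewrite normrM.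
Qed.

Lemma sum_enum_val (R : realType) (V : finType) (F : V -> R) :
  \sum_(i < #|V|) F (enum_val i) = \sum_v F v.
Proof.
by rewrite (reindex (@enum_val V predT)) //=; exact/onW_bij/enum_val_bij.
Qed.

(** The unit sphere is compact and the form is continuous, so a maximum is attained there;
    homogeneity carries it to every [y]. The vertex [v0] makes the sphere nonempty. *)
Lemma quad_max (R : realType) (V : finType) (e : rel V) (v0 : V) :
  exists x : V -> R, \sum_v x v ^+ 2 = 1 /\
    forall y : V -> R, quad e y <= quad e x * \sum_v y v ^+ 2.
Proof.
pose n := #|V|.
pose q (u : 'rV[R]_n) : R :=
  \sum_(i < n) \sum_(j < n | e (enum_val i) (enum_val j)) u ord0 i * u ord0 j.
pose s (u : 'rV[R]_n) : R := \sum_(i < n) u ord0 i ^+ 2.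
have cc i : continuous (fun u : 'rV[R]_n => u ord0 i).
  exact: coord_continuous.
have cs : continuous s.
  apply: continuous_big => [|i _ u]; first exact: add_continuous.
  exact: (cvgM (cc i u) (cc i u)).
have cq : continuous q.
  apply: continuous_big => [|i _]; first exact: add_continuous.
  apply: continuous_big => [|j _ u]; first exact: add_continuous.
  exact: (cvgM (cc i u) (cc j u)).
pose A := [set u | s u = 1]%classic.
have qE (x : V -> R) : q (\row_i x (enum_val i)) = quad e x.
  rewrite /q /quad -[RHS]sum_enum_val; apply: eq_bigr => i _.
  rewrite [RHS]big_mkcond /= -[RHS]sum_enum_val [LHS]big_mkcond /=.
  by apply: eq_bigr => j _; rewrite !mxE.
have sE (x : V -> R) : s (\row_i x (enum_val i)) = \sum_v x v ^+ 2.
  by rewrite /s -[RHS]sum_enum_val; apply: eq_bigr => i _; rewrite mxE.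
have rowE (u : 'rV[R]_n) : u = \row_i (u ord0 (enum_rank (enum_val i))).
  by apply/rowP => i; rewrite mxE enum_valK.
have A0 : (A !=set0)%classic.
  exists (\row_i (enum_val i == v0)%:R); rewrite /A /= (sE (fun v => (v == v0)%:R)) (bigD1 v0) //= eqxx.
  by rewrite big1 ?addr0 ?expr1n // => v /negbTE ->; rewrite expr0n.
have cA : compact A.
  apply: bounded_closed_compact; last first.
    have -> : A = (s @^-1` [set 1])%classic by [].
    by apply: closed_comp; [move=> u _; exact: cs | exact: closed_eq].
  exists 1; split => // M M1 u; rewrite /A /= => su.
  rewrite /Num.norm /= mx_normrE; apply: bigmax_le => [|[i j] _ /=].
    by rewrite (le_trans _ (ltW M1)).
  apply: le_trans (ltW M1); rewrite (ord1 i).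
  rewrite -(@ler_pXn2r _ 2) // ?nnegrE // expr1n -su -normrX.
  rewrite ger0_norm ?sqr_ge0 // /s (bigD1 j) //= lerDl.
  by apply: sumr_ge0 => *; exact: sqr_ge0.
have [c cA1 cmax] := EVT_max_rV A0 cA (continuous_subspaceT cq).
exists (fun v => c ord0 (enum_rank v)); split.
  by rewrite -(sE (fun v => c ord0 (enum_rank v))) -rowE; exact: set_mem cA1.
move=> y; set N := \sum_v _.
have N0 : 0 <= N by apply: sumr_ge0 => *; exact: sqr_ge0.
rewrite -(qE (fun v => c ord0 (enum_rank v))) -rowE.
have [Nz|Npos] := eqVneq N 0.
  rewrite Nz mulr0 /quad big1 // => v _; rewrite big1 // => w _.
  have := @psumr_eq0P _ _ predT (fun v => y v ^+ 2) (fun v _ => sqr_ge0 _) Nz v isT.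
  by move/eqP; rewrite sqrf_eq0 => /eqP ->; rewrite mul0r.
have {Npos} Npos : 0 < N by rewrite lt_def Npos.
pose r := Num.sqrt N.
have r2 : r ^+ 2 = N by rewrite sqr_sqrtr.
have rn0 : r != 0 by rewrite sqrtr_eq0 -ltNge.
have := cmax (\row_i (y (enum_val i) / r)).
move=> /(_ (mem_set _)); rewrite /A /= (sE (fun v => y v / r)) (qE (fun v => y v / r)).
have -> : \sum_v (y v / r) ^+ 2 = 1.
  under eq_bigr do rewrite exprMn.
  by rewrite -mulr_suml exprVn r2 divff // gt_eqF.
move=> /(_ erefl).
have -> : quad e (fun v => y v / r) = quad e y / N.
  rewrite /quad mulr_suml; apply: eq_bigr => v _; rewrite mulr_suml.
  by apply: eq_bigr => w _; rewrite -r2; field.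
by rewrite ler_pdivrMr.
Qed.

(** Serves twice: as the first variation at a maximiser, and with [s = - x v] as the deletion of the
    vertex [v]. *)
Lemma quad_perturb (R : realType) (V : finType) (e : rel V) (x : V -> R) (s : R)
    (v : V) :
  symmetric e ->
  quad e (fun w => x w + s * (w == v)%:R) =
  quad e x + 2 * s * (\sum_(w | e v w) x w) + s ^+ 2 * (e v v)%:R.
Proof.
move=> es; pose d (w : V) : R := (w == v)%:R.
have E a b : (x a + s * d a) * (x b + s * d b) =
    x a * x b + s * (d a * x b) + (s * (x a * d b) + s ^+ 2 * (d a * d b)).
  by ring.
rewrite /quad; under eq_bigr do under eq_bigr do rewrite E.
have dsum (F : V -> R) : \sum_u d u * F u = F v.
  rewrite (bigD1 v) //= /d eqxx mul1r big1 ?addr0 //.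
  by move=> w /negbTE ->; rewrite mul0r.
have h1 : \sum_u \sum_(w | e u w) s * (d u * x w) = s * \sum_(w | e v w) x w.
  rewrite -[X in s * X](dsum (fun u => \sum_(w | e u w) x w)) mulr_sumr.
  by apply: eq_bigr => u _; rewrite !mulr_sumr.
have h2 : \sum_u \sum_(w | e u w) s * (x u * d w) = s * \sum_(w | e v w) x w.
  rewrite -h1 (exchange_big_dep predT) //=; apply: eq_bigr => u _.
  by apply: eq_big => [w|w _]; [rewrite es | rewrite (mulrC (x w))].
have h3 : \sum_u \sum_(w | e u w) s ^+ 2 * (d u * d w) = s ^+ 2 * (e v v)%:R.
  under eq_bigr do rewrite -mulr_sumr -mulr_sumr.
  rewrite -mulr_sumr dsum big_mkcond /=; congr (_ * _).
  rewrite -(dsum (fun w => (e v w)%:R)); apply: eq_bigr => w _.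
  by case: (e v w); rewrite ?mulr1 ?mulr0.
under eq_bigr do rewrite !big_split /=.
by rewrite !big_split /= h1 h2 h3; ring.
Qed.

Lemma quad_maximizer_eigen (R : realType) (V : finType) (e : rel V) (l : R)
    (x : V -> R) :
  symmetric e -> \sum_v x v ^+ 2 = 1 -> quad e x = l ->
  (forall y, quad e y <= l * \sum_v y v ^+ 2) ->
  forall v, l * x v = \sum_(w | e v w) x w.
Proof.
move=> es x1 qx ub v.
pose c := l * x v - \sum_(w | e v w) x w.
suff : c = 0 by move/eqP; rewrite subr_eq0 => /eqP.
pose d (w : V) : R := (w == v)%:R.
(* Moving along the coordinate [v] cannot beat the maximum. A quadratic in [s] without constant term
   that stays nonnegative has no linear term: otherwise [s = - c], or the vertex
   [s = - c / (l - e v v)] of the parabola, makes it negative. *)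
have key (s : R) : 0 <= 2 * s * c + s ^+ 2 * (l - (e v v)%:R).
  have := ub (fun w => x w + s * d w); rewrite -subr_ge0 /d quad_perturb //.
  have -> : \sum_w (x w + s * d w) ^+ 2 = 1 + 2 * s * x v + s ^+ 2.
    under eq_bigr do rewrite sqrrD.
    rewrite !big_split /= x1; congr (_ + _ + _).
      rewrite (bigD1 v) //= /d eqxx big1 ?addr0 /= ?mulr1; first by ring.
      by move=> w /negbTE ->; rewrite !mulr0 ?mul0rn.
    rewrite (bigD1 v) //= /d eqxx big1 ?addr0 ?mulr1 //.
    by move=> w /negbTE ->; rewrite mulr0 expr0n.
  by rewrite /c qx; set Q := (e v v)%:R; set S := \sum_(w | e v w) x w; lra.
have [//|cn0] := eqVneq c 0.
have [D0|D0] := leP (l - (e v v)%:R) 0.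
  have := key (- c); rewrite -subr_ge0 => h.
  suff : 0 < c ^+ 2 by move: h D0; nra.
  by rewrite exprn_even_gt0.
have c2 : 0 < c ^+ 2 by rewrite exprn_even_gt0.
have := key (- c / (l - (e v v)%:R)); set D := l - _ in D0 *.
have -> : 2 * (- c / D) * c + (- c / D) ^+ 2 * D = - (c ^+ 2 / D).
  by field; rewrite gt_eqF.
by rewrite oppr_ge0 leNgt divr_gt0.
Qed.

(* The maximiser of the quadratic form on the unit sphere can be taken
   nonnegative, so its value bounds every eigenvalue in modulus. *)
Lemma perron_rayleigh (R : realType) (V : finType) (e : rel V) (v0 : V) :
  symmetric e ->
  (forall y, quad e y <= spec_rad R e * \sum_v y v ^+ 2) /\
  exists x : V -> R,
    [/\ forall v, 0 <= x v, \sum_v x v ^+ 2 = 1 &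
        forall v, spec_rad R e * x v = \sum_(w | e v w) x w].
Proof.
move=> es; have [x0 [x01 x0max]] := quad_max R e v0.
pose l := quad e x0.
pose x v := `|x0 v|.
have x1 : \sum_v x v ^+ 2 = 1.
  by rewrite -x01; apply: eq_bigr => v _; rewrite /x real_normK ?num_real.
have qx : quad e x = l.
  apply/eqP; rewrite eq_le; apply/andP; split.
    by have := x0max x; rewrite x1 mulr1.
  by apply: le_trans (quad_abs_le e x0); exact: ler_norm.
have ex := quad_maximizer_eigen es x1 qx x0max.
have xge0 v : 0 <= x v by rewrite /x.
have l0 : 0 <= l.
  rewrite -qx /quad; apply: sumr_ge0 => v _; apply: sumr_ge0 => w _.
  exact: mulr_ge0.
pose E := [set `|a| | a in [set a : R | eigenvalue (adjmx R e) a]]%classic.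
have El : E l.
  exists l; last by rewrite ger0_norm.
  apply/eigenvalueP; exists (\row_i x (enum_val i)).
    apply/rowP => i; rewrite !mxE ex [RHS]big_mkcond /= -[RHS]sum_enum_val.
    apply: eq_bigr => j _; rewrite !mxE es.
    by case: ifP => _; rewrite ?mulr1 ?mulr0.
  apply/eqP => /rowP z; have := x1; rewrite big1 => [/esym/eqP|v _].
    by rewrite oner_eq0.
  have := z (enum_rank v); rewrite !mxE enum_rankK => ->.
  by rewrite expr0n.
(* For an eigenpair [(a, y)], the product of [|a|] and the squared norm of [y] is [|quad e y|], at
   most the form at [|y|]. *)
have Eub : ubound E l.
  move=> _ [a /= /eigenvalueP[u ua un0] <-].
  pose y v := u ord0 (enum_rank v).
  have ey v : a * y v = \sum_(w | e v w) y w.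
    have /rowP/(_ (enum_rank v)) := ua; rewrite !mxE => <-.
    rewrite [RHS]big_mkcond /= -[RHS]sum_enum_val; apply: eq_bigr => j _.
    rewrite !mxE enum_rankK es /y enum_valK.
    by case: ifP => _; rewrite ?mulr1 ?mulr0.
  have qy : quad e y = a * \sum_v y v ^+ 2.
    rewrite /quad mulr_sumr; apply: eq_bigr => v _.
    by rewrite -mulr_sumr -ey expr2; ring.
  have N0 : 0 < \sum_v y v ^+ 2.
    rewrite lt_def; apply/andP; split; last first.
      by apply: sumr_ge0 => *; exact: sqr_ge0.
    apply: contra un0 => /eqP z; apply/eqP/rowP => i; rewrite mxE.
    have := @psumr_eq0P _ _ predT (fun v => y v ^+ 2) (fun v _ => sqr_ge0 _) z
      (enum_val i) isT.
    by move/eqP; rewrite sqrf_eq0 /y enum_valK => /eqP.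
  have := le_trans (quad_abs_le e y) (x0max _).
  rewrite qy normrM (ger0_norm (ltW N0)) -/l.
  have -> : \sum_v `|y v| ^+ 2 = \sum_v y v ^+ 2.
    by apply: eq_bigr => v _; rewrite real_normK ?num_real.
  by rewrite ler_pM2r.
have sE : spec_rad R e = l.
  apply/eqP; rewrite eq_le; apply/andP; split.
    by apply: ge_sup => //; exists l.
  by apply: ub_le_sup => //; exists l.
rewrite sE; split => //; exists x; split => //.
Qed.

(** Nonnegative rather than positive, since the graph may be disconnected; [l] is a parameter, so
    the notion serves a graph and its induced subgraphs alike. *)
Definition perron (R : realType) (V : finType) (e : rel V) (l : R) (x : V -> R) :=
  [/\ forall v, 0 <= x v, \sum_v x v ^+ 2 = 1 &
      forall v, l * x v = \sum_(w | e v w) x w].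

Lemma cauchy_schwarz (R : realType) (I : finType) (P : pred I) (a b : I -> R) :
  (\sum_(i | P i) a i * b i) ^+ 2 <=
  (\sum_(i | P i) a i ^+ 2) * (\sum_(i | P i) b i ^+ 2).
Proof.
set A := \sum_(i | P i) a i ^+ 2; set B := \sum_(i | P i) b i ^+ 2.
set C := \sum_(i | P i) _.
have B0 : 0 <= B by apply: sumr_ge0 => i _; exact: sqr_ge0.
have [Bz|Bn] := eqVneq B 0.
  rewrite Bz mulr0 /C big1 ?expr0n // => i Pi.
  have /eqP := @psumr_eq0P _ _ P (fun i => b i ^+ 2) (fun i _ => sqr_ge0 _) Bz i Pi.
  by rewrite sqrf_eq0 => /eqP ->; rewrite mulr0.
have {}B0 : 0 < B by rewrite lt_def Bn.
have : 0 <= \sum_(i | P i) (B * a i - C * b i) ^+ 2.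
  by apply: sumr_ge0 => i _; exact: sqr_ge0.
have -> : \sum_(i | P i) (B * a i - C * b i) ^+ 2 = B * (A * B - C ^+ 2).
  have E i : (B * a i - C * b i) ^+ 2 =
    B ^+ 2 * a i ^+ 2 + (- 2 * B * C * (a i * b i) + C ^+ 2 * b i ^+ 2) by ring.
  under eq_bigr do rewrite E.
  by rewrite !big_split /= -!mulr_sumr -/A -/B -/C; ring.
by rewrite pmulr_rge0 // subr_ge0.
Qed.

Lemma sum_sqr_le (R : realType) (I : finType) (P : pred I) (a : I -> R) :
  (\sum_(i | P i) a i) ^+ 2 <= (\sum_(i | P i) 1) * \sum_(i | P i) a i ^+ 2.
Proof.
have := cauchy_schwarz P (fun=> 1) a.
under eq_bigr do rewrite mul1r.
by under [in X in _ <= X * _]eq_bigr do rewrite expr1n.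
Qed.

Lemma ler_psum (R : realType) (I : finType) (P Q : pred I) (F : I -> R) :
  (forall i, P i -> Q i) -> (forall i, Q i -> 0 <= F i) ->
  \sum_(i | P i) F i <= \sum_(i | Q i) F i.
Proof.
move=> PQ F0; rewrite (bigID P Q) /=.
have -> : \sum_(i | Q i && P i) F i = \sum_(i | P i) F i.
  by apply: eq_bigl => i; case Pi: (P i); rewrite ?andbF ?andbT // PQ.
by rewrite lerDl; apply: sumr_ge0 => i /andP[/F0].
Qed.

Lemma sum1r_card (R : realType) (I : finType) (P : pred I) :
  \sum_(i | P i) 1 = #|P|%:R :> R.
Proof. by rewrite sumr_const. Qed.

Lemma handshake (R : realType) (V : finType) (e : rel V) : simple_graph e ->
  \sum_v \sum_(w | e v w) 1 = 2 * #|edges e|%:R :> R.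
Proof.
move=> [es ei]; rewrite pair_big_dep /= sum1r_card.
pose D := [set p : V * V | e p.1 p.2].
have -> : #|(fun p : V * V => e p.1 p.2)| = #|D|.
  by apply: eq_card => p; rewrite inE.
rewrite -natrM; congr (_%:R).
pose h (p : V * V) := [set p.1; p.2].
rewrite -sum1_card (partition_big h [in edges e]) /=; last first.
  move=> [a b]; rewrite !inE /= => ab.
  by apply/existsP; exists a; apply/existsP; exists b; rewrite ab eqxx.
rewrite mulnC -sum_nat_const; apply: eq_bigr => E.
rewrite inE => /existsP[a /existsP[b /andP[ab /eqP ->]]].
have anb : a != b by apply: contraTneq ab => ->; rewrite ei.
rewrite sum1_card (@eq_card _ _ [set (a, b); (b, a)]).
  by rewrite cards2 xpair_eqE (negbTE anb).
move=> [c d]; rewrite !inE /h /= !xpair_eqE unfold_in /= inE /=.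
apply/idP/idP.
  move=> /andP[cd /eqP /setP cdE].
  have cnd : c != d by apply: contraTneq cd => ->; rewrite ei.
  have := cdE c; have := cdE d; rewrite !inE !eqxx orbT /=.
  by move=> /esym/orP[]/eqP dE /esym/orP[]/eqP cE;
    rewrite dE cE ?eqxx ?orbT // in cnd *.
by case/orP => /andP[/eqP -> /eqP ->]; rewrite ?ab ?(es b a) ?ab ?eqxx // setUC eqxx.
Qed.

Lemma perron_quad (R : realType) (V : finType) (e : rel V) (l : R) (x : V -> R) :
  perron e l x -> quad e x = l.
Proof.
move=> [_ x1 ex]; rewrite /quad.
under eq_bigr => v _ do rewrite -mulr_sumr -ex mulrCA -expr2.
by rewrite -mulr_sumr x1 mulr1.
Qed.

Lemma perron_le1 (R : realType) (V : finType) (e : rel V) (l : R) (x : V -> R)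
    (P : pred V) : perron e l x -> \sum_(v | P v) x v ^+ 2 <= 1.
Proof.
move=> [_ <- _]; apply: ler_psum => // *; exact: sqr_ge0.
Qed.

Lemma perron_sqr_le (R : realType) (V : finType) (e : rel V) (l : R) (x : V -> R) v :
  perron e l x ->
  l ^+ 2 * x v ^+ 2 <= (\sum_(w | e v w) 1) * \sum_(w | e v w) x w ^+ 2.
Proof. by move=> [_ _ ex]; rewrite -exprMn ex; exact: sum_sqr_le. Qed.

Lemma perron_sqr_le_deg (R : realType) (V : finType) (e : rel V) (l : R)
    (x : V -> R) v : perron e l x -> l ^+ 2 * x v ^+ 2 <= \sum_(w | e v w) 1.
Proof.
move=> px; apply: le_trans (perron_sqr_le v px) _.
by rewrite ler_piMr ?(perron_le1 _ px) // sumr_ge0.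
Qed.

Lemma sum_pairs_sqr_le (R : realType) (V : finType) (P Q : pred V) (e : rel V)
    (x : V -> R) :
  (\sum_(v | P v) \sum_(w | Q w && e v w) x v * x w) ^+ 2 <=
  (\sum_(v | P v) \sum_(w | Q w && e v w) 1) *
  ((\sum_(v | P v) x v ^+ 2) * \sum_(w | Q w) x w ^+ 2).
Proof.
rewrite !pair_big_dep /=; apply: le_trans (sum_sqr_le _ _) _.
apply: ler_wpM2l; first by rewrite sumr_ge0.
rewrite mulr_suml.
under [leRHS]eq_bigr do rewrite mulr_sumr.
rewrite pair_big_dep /=; under eq_bigr do rewrite exprMn.
apply: ler_psum => [[v w] /= /andP[-> /andP[->]] //|i _].
by rewrite mulr_ge0 ?sqr_ge0.
Qed.

Lemma perron_sqr_le_vol (R : realType) (V : finType) (e : rel V) (l : R)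
    (x : V -> R) : perron e l x -> l ^+ 2 <= \sum_v \sum_(w | e v w) 1.
Proof.
move=> px; rewrite -(perron_quad px).
have := sum_pairs_sqr_le predT predT e x; case: (px) => _ -> _.
by rewrite !mulr1.
Qed.

(** Here [l] is twice the form across the cut. Cauchy-Schwarz bounds the square of the latter by the
    number of edges times the product of the weights of the two classes, which is at most 1/4 as
    they sum to 1. *)
Lemma perron_bipartite (R : realType) (V : finType) (e : rel V) (l : R)
    (x : V -> R) (P : {set V}) :
  symmetric e -> perron e l x ->
  (forall u v, e u v -> (u \in P) != (v \in P)) ->
  2 * l ^+ 2 <= \sum_v \sum_(w | e v w) 1.
Proof.
move=> es px bip.
have split2 (F : V -> V -> R) : (forall u v, F u v = F v u) ->
    \sum_v \sum_(w | e v w) F v w =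
    2 * \sum_(v in P) \sum_(w | (w \notin P) && e v w) F v w.
  move=> Fs; rewrite (bigID [in P]) /= mulr2n mulrDl !mul1r; congr (_ + _).
    apply: eq_bigr => v vP; apply: eq_bigl => w.
    case ew: (e v w); rewrite ?andbF ?andbT //.
    by have := bip _ _ ew; rewrite vP; case: (w \in P).
  rewrite [RHS](exchange_big_dep [predC P]) /=; last by move=> ? ? _ /andP[].
  apply: eq_bigr => v vP; apply: eq_big => [w|w _]; last exact: Fs.
  rewrite es; case ew: (e w v); rewrite ?andbF // andbT.
  by have := bip _ _ ew; rewrite (negbTE vP) ?vP; case: (w \in P).
rewrite split2 // -(perron_quad px) /quad split2; last by move=> *; rewrite mulrC.
have := sum_pairs_sqr_le [in P] (fun w => w \notin P) e x.
set C := (\sum_(v in P) \sum_(w | _) _ * _).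
set N := (\sum_(v in P) \sum_(w | _) 1).
have N0 : 0 <= N by apply: sumr_ge0 => *; apply: sumr_ge0.
have : \sum_(v in P) x v ^+ 2 + \sum_(v | v \notin P) x v ^+ 2 = 1.
  by case: px => _ <- _; rewrite [RHS](bigID [in P]).
set a := \sum_(v in P) _; set b := \sum_(v | _) _ => ab le1.
have : a * b <= 1 / 4.
  have -> : b = 1 - a by lra.
  by have := sqr_ge0 (a - 1 / 2); lra.
rewrite exprMn => h; have : N * (a * b) <= N * (1 / 4) by apply: ler_wpM2l.
lra.
Qed.

(** * Graphs without atoms *)

(** Listing [u], [v] and then [K] puts the edge [uv] on the indices 0 and 1, where [Kplus_rel] has
    its extra edge. The two sides are disjoint because they are completely joined and there are no
    loops. *)
Lemma Kplus_subgraph (k t : nat) (V : finType) (e : rel V) (u v : V)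
    (K Y : {set V}) :
  simple_graph e -> (0 < k)%N -> (k.-1 <= #|K|)%N -> (t < #|Y|)%N ->
  u \notin K -> v \notin K -> e u v ->
  (forall y, y \in Y -> e u y && e v y) ->
  (forall w y, w \in K -> y \in Y -> e w y) ->
  has_subgraph (@Kplus_rel k t) e.
Proof.
move=> [es ei] k0 Kk Yt uK vK uv uvY KY.
have unv : u != v by apply: contraTneq uv => ->; rewrite ei.
pose s := [:: u, v & enum K].
have us : uniq s by rewrite /= !inE !mem_enum negb_or unv uK vK enum_uniq.
have ss (a : 'I_k.+1) : (a < size s)%N.
  by rewrite /= -cardE; case: a => a /= h; lia.
have sY (b : 'I_t.+1) : (b < size (enum Y))%N.
  by rewrite -cardE; case: b => b /= h; lia.
pose phi (a : 'I_k.+1 + 'I_t.+1) :=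
  match a with inl i => nth u s i | inr j => nth u (enum Y) j end.
have eXY i j : e (phi (inl i)) (phi (inr j)).
  have : phi (inr j) \in Y by rewrite -mem_enum mem_nth.
  have : phi (inl i) \in s by rewrite mem_nth.
  by rewrite !inE mem_enum => /or3P[/eqP->|/eqP->|iK] /[dup] jY /uvY /andP[] //
    _ _; apply: KY.
exists phi; split.
  move=> [a|a] [b|b] /eqP.
  - by rewrite /phi nth_uniq // => /eqP/val_inj ->.
  - by move=> /eqP E; have := eXY a b; rewrite E ei.
  - by move=> /eqP E; have := eXY b a; rewrite E ei.
  - by rewrite /phi nth_uniq ?enum_uniq // => /eqP/val_inj ->.
move=> [a|a] [b|b] //=.
- by case/orP => /andP[/eqP -> /eqP ->] //=; rewrite es.
- by move=> _; exact: (eXY a b).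
- by move=> _; rewrite es; exact: (eXY b a).
Qed.

Lemma subset_card_eq (V : finType) (A : {set V}) n : (n <= #|A|)%N ->
  exists2 B : {set V}, B \subset A & #|B| = n.
Proof.
move=> nA; exists [set x in take n (enum A)].
  by apply/subsetP => x; rewrite inE => /mem_take; rewrite mem_enum.
rewrite cardsE (card_uniqP _) ?take_uniq ?enum_uniq // size_takel //.
by rewrite -cardE.
Qed.

(** A weighted Kovari-Sos-Turan argument. If the common neighbourhood [C] of [u] and [v] were heavy,
    many vertices would each see a sixth of it, and pigeonhole would find k - 1 of them with t + 1
    common neighbours in [C]. The bound on single weights turns weights into cardinalities. *)
Lemma codegree_lt (R : realType) (k t h : nat) (V : finType) (e : rel V)
    (y : V -> R) (u v : V) :
  simple_graph e -> (2 <= k)%N -> F_free (@Kplus_rel k t) e ->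
  (360 * 2 ^ (12 * k) * t.+1 <= h)%N ->
  (forall w, 0 <= y w) -> \sum_w y w = 1 -> (forall w, y w * h%:R <= 1) ->
  (forall w z, e w z -> 7 / 15 <= \sum_(c | e w c) y c) ->
  e u v -> \sum_(c | e u c && e v c) y c < 1 / 30.
Proof.
move=> ge k2 Ff hh y0 y1 yh ydeg uv; have [es ei] := ge.
rewrite ltNge; apply/negP => big.
pose C := [set c | e u c && e v c].
pose yC := \sum_(c in C) y c.
have yCbig : 1 / 30 <= yC.
  by apply: le_trans big _; rewrite /yC; under [leRHS]eq_bigl do rewrite inE.
have h0 : 0 < h%:R :> R.
  rewrite ltr0n; apply: leq_trans hh; rewrite !muln_gt0 expn_gt0 //.
pose f w := \sum_(c | (c \in C) && e w c) y c.
have fC w : f w <= yC.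
  by apply: ler_psum => // c /andP[].
have f0 w : 0 <= f w by apply: sumr_ge0.
have hsum : 7 / 15 * yC <= \sum_w y w * f w.
  rewrite mulr_sumr.
  have -> : \sum_w y w * f w = \sum_(c in C) y c * \sum_(w | e c w) y w.
    under eq_bigr do rewrite mulr_sumr.
    rewrite (exchange_big_dep [in C]) /=; last by move=> ? ? _ /andP[].
    apply: eq_bigr => c cC; rewrite mulr_sumr; apply: eq_big => [w|w _].
      by rewrite cC es.
    by rewrite mulrC.
  apply: ler_sum => c; rewrite inE => /andP[uc _]; rewrite mulrC.
  by apply: ler_wpM2l => //; apply: (ydeg c u); rewrite es.
pose Wg := [set w | yC / 6 <= f w].
(* The mean of [f] is at least 7/15 of [yC]; vertices outside [Wg] account for at most 1/6 of it,
   and 7/15 - 1/6 = 3/10. *)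
have yWg : 3 / 10 <= \sum_(w in Wg) y w.
  have up : \sum_w y w * f w <= yC * \sum_(w in Wg) y w + yC / 6.
    rewrite (bigID [in Wg]) /= mulr_sumr; apply: lerD.
      by apply: ler_sum => w _; rewrite mulrC; apply: ler_wpM2r.
    apply: (@le_trans _ _ (\sum_(w | w \notin Wg) y w * (yC / 6))).
      apply: ler_sum => w; rewrite inE -ltNge => /ltW; exact: ler_wpM2l.
    rewrite -mulr_suml ler_piMl //; first lra.
    by rewrite -[leRHS]y1; apply: ler_psum.
  have yCp : 0 < yC by lra.
  have : yC * (3 / 10) <= yC * \sum_(w in Wg) y w by lra.
  by rewrite ler_pM2l.
(* Two vertices beyond 12k, since [u] and [v] are removed next. *)
have cWg : (12 * k + 2 <= #|Wg|)%N.
  have e1 : (\sum_(w in Wg) y w) * h%:R <= #|Wg|%:R.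
    rewrite mulr_suml -(@sum1r_card R _ [in Wg]); exact: ler_sum.
  have e2 : 3 / 10 * h%:R <= (#|Wg|%:R : R).
    by apply: le_trans e1; rewrite ler_pM2r.
  have e3 : (3 * h <= 10 * #|Wg|)%N.
    by rewrite -(ler_nat R) !natrM; lra.
  have := ltn_expl (12 * k) (isT : (1 < 2)%N).
  by move: hh e3; set p := (2 ^ _)%N; nia.
have [Q QW cQ] : exists2 Q : {set V}, Q \subset Wg :\: [set u; v] &
    #|Q| = (12 * k)%N.
  apply: subset_card_eq; rewrite cardsD.
  have := cards2 u v; have := subset_leq_card (subsetIr Wg [set u; v]).
  by case: (u != v) => /=; lia.
pose D c := [set w in Q | e w c].
pose C1 := [set c in C | (k.-1 <= #|D c|)%N].
(* Double counting between [C] and [Q] gives at least 12k [yC]/6 = 2k [yC]. Vertices outside [C1]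
   contribute at most (k - 1) [yC], those of [C1] at most 12k times their weight; so [C1] weighs at
   least [yC]/12, that is 1/360. *)
have yC1 : 1 / 360 <= \sum_(c in C1) y c.
  have e1 : \sum_(c in C) y c * #|D c|%:R = \sum_(w in Q) f w.
    rewrite [RHS](exchange_big_dep [in C]) /=; last by move=> ? ? _ /andP[].
    apply: eq_bigr => c cC; rewrite -(@sum1r_card R _ [in D c]) mulr_sumr.
    by apply: eq_big => [w|w _]; rewrite ?mulr1 // inE cC.
  have e2 : (12 * k)%:R * (yC / 6) <= \sum_(w in Q) f w.
    rewrite -cQ -[X in X * _](@sum1r_card R _ [in Q]) mulr_suml.
    apply: ler_sum => w /(subsetP QW); rewrite !inE mul1r.
    by case/andP.
  have e3 : \sum_(c in C) y c * #|D c|%:R <=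
      (12 * k)%:R * (\sum_(c in C1) y c) + k.-1%:R * yC.
    rewrite (bigID [in C1]) /=; apply: lerD.
      rewrite mulr_sumr; rewrite [leRHS](eq_bigl (fun c => (c \in C) && (c \in C1))).
        apply: ler_sum => c _; rewrite mulrC; apply: ler_wpM2r => //.
        by rewrite ler_nat -cQ subset_leq_card //; apply/subsetP => w /[!inE] /andP[].
      by move=> c; rewrite !inE; case: (e u c && e v c).
    apply: (@le_trans _ _ (\sum_(c | (c \in C) && (c \notin C1)) y c * k.-1%:R)).
      apply: ler_sum => c /andP[cC]; rewrite inE cC /= -ltnNge => /ltnW le.
      by apply: ler_wpM2l => //; rewrite ler_nat.
    rewrite -mulr_suml mulrC; apply: ler_wpM2l => //.
    by apply: ler_psum => // c /andP[].
  have kE : (k.-1)%:R = k%:R - 1 :> R by rewrite -[in RHS](ltn_predK k2) -natr1; ring.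
  have kp : 0 < k%:R :> R by rewrite ltr0n; lia.
  set Y := \sum_(c in C1) y c in e3 *.
  rewrite natrM in e2 e3; rewrite kE e1 in e3.
  have : k%:R * (yC / 12) <= k%:R * Y by lra.
  by rewrite ler_pM2l //; lra.
(* Pigeonhole over the subsets of [Q]: more than t vertices of [C1] with the same trace [E] on [Q]
   would form the forbidden graph with [u], [v] and [E]. *)
have small : (\sum_(c in C1) y c) * h%:R <= (2 ^ (12 * k) * t)%:R.
  rewrite (partition_big D [in powerset Q]) /=; last first.
    by move=> c _; rewrite powersetE; apply/subsetP => w /[!inE] /andP[].
  rewrite mulr_suml natrM -cQ -card_powerset.
  rewrite -[X in _ <= X * _](@sum1r_card R _ [in powerset Q]) mulr_suml.
  apply: ler_sum => E _; rewrite mul1r.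
  pose Y := [set c in C1 | D c == E].
  apply: (@le_trans _ _ (#|Y|%:R)).
    rewrite mulr_suml -(@sum1r_card R _ [in Y]).
    under [leRHS]eq_bigl do rewrite inE.
    exact: ler_sum.
  rewrite ler_nat leqNgt; apply/negP => tY; apply: Ff.
  have [c cY] : exists c, c \in Y by apply/card_gt0P; lia.
  move: (cY); rewrite !inE => /andP[/andP[_ kD] /eqP DE].
  apply: (@Kplus_subgraph k t V e u v E Y) => //; first by lia.
  - by rewrite -DE.
  - by rewrite -DE inE; apply/negP => /andP[/(subsetP QW)]; rewrite !inE eqxx.
  - by rewrite -DE inE; apply/negP => /andP[/(subsetP QW)]; rewrite !inE eqxx orbT.
  - by move=> z; rewrite !inE => /andP[/andP[]].
  - by move=> w z wE; rewrite inE => /andP[_ /eqP zE]; move: wE; rewrite -zE inE => /andP[].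
have e1 : 1 / 360 * h%:R <= (2 ^ (12 * k) * t)%:R :> R.
  by apply: le_trans small; rewrite ler_pM2r.
have : (h <= 360 * (2 ^ (12 * k) * t))%N by rewrite -(ler_nat R) natrM; lra.
have : (0 < 2 ^ (12 * k))%N by rewrite expn_gt0.
by move: hh; set p := (2 ^ _)%N; nia.
Qed.

(* With all weighted degrees close to 1/2 and negligible codegrees on edges,
   the neighbourhoods of two vertices with a common neighbour nearly coincide. *)
Lemma bipartite_of_codegree (R : realType) (V : finType) (e : rel V)
    (y : V -> R) :
  simple_graph e -> (forall w, 0 <= y w) -> \sum_w y w = 1 ->
  (forall w z, e w z -> 7 / 15 <= \sum_(c | e w c) y c) ->
  (forall u v, e u v -> \sum_(c | e u c && e v c) y c < 1 / 30) ->
  exists P : {set V}, forall u v, e u v -> (u \in P) != (v \in P).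
Proof.
move=> [es ei] y0 y1 ydeg cod.
have [/existsP[u /existsP[v uv]]|/existsP noe] := boolP [exists u, [exists v, e u v]];
  last first.
  by exists set0 => u v uv; case: noe; exists u; apply/existsP; exists v.
pose pI (P Q : pred V) : pred V := fun c => P c && Q c.
pose pU (P Q : pred V) : pred V := fun c => P c || Q c.
pose pC (P : pred V) : pred V := fun c => ~~ P c.
have pIr P Q c : pI P Q c -> Q c by case/andP.
pose mu (P : pred V) := \sum_(c | P c) y c.
have muU (P Q : pred V) : mu P + mu Q = mu (pU P Q) + mu (pI P Q).
  rewrite /mu (big_mkcond P) (big_mkcond Q) (big_mkcond (pU P Q)) /=.
  rewrite (big_mkcond (pI P Q)) /= -!big_split; apply: eq_bigr => c _ /=.
  by rewrite /pU /pI; case: (P c); case: (Q c); rewrite /= ?addr0 ?add0r.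
have muS (P Q : pred V) : (forall c, P c -> Q c) -> mu P <= mu Q.
  by move=> PQ; apply: ler_psum.
have mu1 (P : pred V) : mu P <= 1 by rewrite -y1; apply: ler_psum.
have muI (P Q S : pred V) : (forall c, P c -> S c) -> (forall c, Q c -> S c) ->
   mu P + mu Q - mu S <= mu (pI P Q).
  move=> PS QS; rewrite muU.
  have : mu (pU P Q) <= mu S.
    by apply: muS => c /orP[/PS|/QS].
  lra.
have muC (P : pred V) : mu (pC P) = 1 - mu P.
  by rewrite -y1 [\sum_w _](bigID P) /= /mu addrAC subrr add0r.
have muD (P Q : pred V) : mu P = mu (pI P Q) + mu (pI P (pC Q)).
  by rewrite /mu (bigID Q).
have cod' a b : e a b -> mu (pI (e a) (e b)) < 1 / 30 by exact: cod.
have deg a b : e a b -> 7 / 15 <= mu (e a) by exact: ydeg.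
have degU : mu (e u) <= 17 / 30.
  have := muU (e u) (e v); have := cod' _ _ uv; have := mu1 (pU (e u) (e v)).
  by have := deg v u; rewrite es => /(_ uv); lra.
(* Outside the neighbourhood of [c] there is weight at most 8/15, while [z] and [u] each see at
   least 7/15 - 1/30 = 13/30 there; they share at least 26/30 - 16/30 = 1/3. *)
have near z c : e u c -> e z c -> 1 / 2 - 1 / 6 <= mu (pI (e z) (e u)).
  move=> uc zc.
  have h1 : mu (pI (pI (e z) (pC (e c))) (pI (e u) (pC (e c)))) <=
      mu (pI (e z) (e u)).
    by apply: muS => w /andP[/andP[wz _] /andP[wu _]]; rewrite /pI wz.
  have h2 := @muI (pI (e z) (pC (e c))) (pI (e u) (pC (e c))) (pC (e c)).
  have {}h2 := h2 (@pIr _ _) (@pIr _ _).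
  have h3 := muD (e z) (e c); have h4 := muD (e u) (e c).
  have h5 := muC (e c); have h6 := deg _ _ zc; have h7 := deg _ _ uc.
  have h8 := cod' _ _ zc; have h9 := cod' _ _ uc.
  have h10 : 7 / 15 <= mu (e c) by apply: (deg c u); rewrite es.
  lra.
(* One side consists of the vertices with a common neighbour with [u]. For an edge [ab] inside it,
   both neighbourhoods meet that of [u], of weight at most 17/30, in at least 1/3, so they overlap
   in at least 1/10. For an edge inside the other side, both avoid the neighbourhood of [u] and
   overlap even more. Either contradicts the codegree bound. *)
exists [set z | [exists c, e u c && e z c]] => a b ab.
rewrite !inE; apply/negP => /eqP ab_side.
have codab := cod' _ _ ab.
have [/existsP[c /andP[uc ac]]|na] := boolP [exists c, e u c && e a c].
  move: ab_side; rewrite (_ : [exists c, e u c && e a c]); last first.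
    by apply/existsP; exists c; rewrite uc.
  move=> /esym/existsP[d /andP[ud bd]].
  have h1 := near _ _ uc ac; have h2 := near _ _ ud bd.
  have h3 := @muI (pI (e a) (e u)) (pI (e b) (e u)) (e u)
     (@pIr _ _) (@pIr _ _).
  have h4 : mu (pI (pI (e a) (e u)) (pI (e b) (e u))) <= mu (pI (e a) (e b)).
    by apply: muS => w /andP[/andP[wz _] /andP[wu _]]; rewrite /pI wz.
  lra.
move: ab_side; rewrite (negbTE na) => /esym/negbT nb.
have h1 := @muI (e a) (e b) (pC (e u)).
have {}h1 : mu (e a) + mu (e b) - mu (pC (e u)) <= mu (pI (e a) (e b)).
  apply: h1 => c ec; apply/negP => uc.
    by case/existsP: na; exists c; rewrite uc.
  by case/existsP: nb; exists c; rewrite uc.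
have := deg _ _ ab; have := deg b a; rewrite es => /(_ ab).
by have := deg _ _ uv; have := muC (e u); lra.
Qed.

(** * Cleaning *)

(** Deleted vertices stay in the type as isolated ones, so that all subgraphs share the vectors on
    [V]. *)
Definition induced (V : finType) (e : rel V) (S : {set V}) : rel V :=
  fun u v => [&& u \in S, v \in S & e u v].

(** The degree sum, twice the number of edges by [handshake]; in this form it is [quad] at the
    constant vector 1. *)
Definition vol (R : realType) (V : finType) (e : rel V) : R :=
  \sum_v \sum_(w | e v w) 1.

Lemma induced_simple (V : finType) (e : rel V) S :
  simple_graph e -> simple_graph (induced e S).
Proof.
move=> [es ei]; split=> [u v|u]; rewrite /induced; last by rewrite ei !andbF.
by rewrite es andbCA.
Qed.

Lemma induced_free (W V : finType) (f : rel W) (e : rel V) S :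
  F_free f e -> F_free f (induced e S).
Proof.
by move=> ff [phi [phi_inj he]]; apply: ff; exists phi; split => // a b /he /and3P[].
Qed.

Lemma quad_ge0 (R : realType) (V : finType) (e : rel V) (x : V -> R) :
  (forall v, 0 <= x v) -> 0 <= quad e x.
Proof.
by move=> x0; apply: sumr_ge0 => v _; apply: sumr_ge0 => w _; exact: mulr_ge0.
Qed.

Lemma spec_rad_ge0 (R : realType) (V : finType) (e : rel V) (v0 : V) :
  symmetric e -> 0 <= spec_rad R e.
Proof.
move=> es; have [_ [x px]] := perron_rayleigh R v0 es.
by rewrite -(perron_quad px); apply: quad_ge0; case: px.
Qed.

Lemma vol_quad (R : realType) (V : finType) (e : rel V) :
  vol R e = quad e (fun=> 1).
Proof. by apply: eq_bigr => v _; apply: eq_bigr => w _; rewrite mulr1. Qed.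

Lemma quad_induced_del (R : realType) (V : finType) (e : rel V) (x : V -> R) S v :
  simple_graph e ->
  quad (induced e (S :\ v)) x =
  quad (induced e S) x - 2 * x v * \sum_(w | induced e S v w) x w.
Proof.
move=> ge; have [es' ei'] := induced_simple S ge.
have := quad_perturb x (- x v) v es'; rewrite ei' mulr0 addr0 mulrN mulNr => <-.
apply: eq_bigr => a _; rewrite [RHS]big_mkcond [LHS]big_mkcond /=.
apply: eq_bigr => b _; rewrite /induced !inE.
have [->|av] := eqVneq a v; first by rewrite /= mulr1 subrr mul0r; case: ifP.
have [->|bv] := eqVneq b v; first by rewrite /= mulr1 subrr mulr0 andbF; case: ifP.
by rewrite /= !mulr0 !addr0.
Qed.

(** The test vector is [x] with its entry at [v] set to 0: by the eigenvalue equation the form loses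
    twice [l] times the weight of [v], and the squared norm loses that weight once. The sign in the
    second part allows the first to be squared. *)
Lemma perron_del_le (R : realType) (V : finType) (e : rel V) (x : V -> R) S v :
  simple_graph e -> perron (induced e S) (spec_rad R (induced e S)) x ->
  spec_rad R (induced e S) * (1 - 2 * x v ^+ 2) <=
    spec_rad R (induced e (S :\ v)) * (1 - x v ^+ 2) /\
  0 <= spec_rad R (induced e S) * (1 - 2 * x v ^+ 2).
Proof.
move=> ge px; have [es' ei'] := induced_simple S ge.
have [es'' _] := induced_simple (S :\ v) ge.
set l := spec_rad R (induced e S) in px *.
have [ray _] := perron_rayleigh R v es''.
pose x' w := x w + - x v * (w == v)%:R.
have x'E : quad (induced e (S :\ v)) x' = l * (1 - 2 * x v ^+ 2).
  rewrite quad_induced_del // /x' eqxx mulr1 subrr mulr0 mul0r subr0.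
  rewrite quad_perturb // ei' (perron_quad px) -/l mulr0 addr0.
  by case: px => _ _ <-; ring.
rewrite -x'E; split; last first.
  apply: quad_ge0 => w; rewrite /x'; case: px => x0 _ _.
  by have [->|] := eqVneq w v; rewrite /= ?mulr1 ?subrr ?mulr0 ?addr0.
apply: le_trans (ray x') _; rewrite le_eqVlt; apply/orP; left; apply/eqP.
congr (_ * _); case: px => _ <- _; rewrite [in RHS](bigD1 v) //= [LHS](bigD1 v) //=.
rewrite /x' eqxx mulr1 subrr expr0n /= add0r addrAC subrr add0r.
by apply: eq_bigr => w /negbTE ->; rewrite mulr0 addr0.
Qed.

(* Deleting vertices whose degree exceeds what the Perron weight pays for can
   only increase [spec_rad ^+ 2 - (29/30) |E|]; maximise it over vertex sets. *)
Lemma exists_clean_subgraph (R : realType) (V : finType) (e : rel V) (v0 : V) :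
  simple_graph e -> exists S : {set V},
    spec_rad R e ^+ 2 - 29 / 60 * vol R e <=
      spec_rad R (induced e S) ^+ 2 - 29 / 60 * vol R (induced e S) /\
    forall x, perron (induced e S) (spec_rad R (induced e S)) x ->
    forall v, 29 / 30 * (\sum_(w | induced e S v w) 1) * (1 - x v ^+ 2) <=
      2 * spec_rad R (induced e S) ^+ 2 * x v ^+ 2.
Proof.
move=> ge.
(* The factor is 29/60 because [vol] counts every edge twice. *)
pose Phi S := spec_rad R (induced e S) ^+ 2 - 29 / 60 * vol R (induced e S).
have [S _ Smax] := @Order.TotalTheory.arg_maxP _ _ _ (setT : {set V}) predT Phi isT.
exists S; split.
  have -> : spec_rad R e ^+ 2 - 29 / 60 * vol R e = Phi setT.
    rewrite /Phi; suff -> : induced e setT = e by [].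
    by apply/funext => u; apply/funext => v; rewrite /induced !in_setT.
  exact: Smax.
move=> x px v; have [del del0] := perron_del_le v ge px.
have : Phi (S :\ v) <= Phi S by exact: Smax.
rewrite /Phi.
have -> : vol R (induced e (S :\ v)) =
    vol R (induced e S) - 2 * \sum_(w | induced e S v w) 1.
  by rewrite !vol_quad quad_induced_del // mulr1.
have l0 := spec_rad_ge0 R v0 (proj1 (induced_simple S ge)).
have l0' := spec_rad_ge0 R v0 (proj1 (induced_simple (S :\ v) ge)).
move: del del0 l0 l0'; set l := spec_rad R (induced e S).
set l' := spec_rad R (induced e (S :\ v)).
set d : R := (\sum_(w | _) 1); set W := vol R _; set y := x v ^+ 2.
move=> del del0 l0 l0' h.
have {}h : 29 / 30 * d <= l ^+ 2 - l' ^+ 2 by move: h; lra.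
have y0 : 0 <= y by exact: sqr_ge0.
have y1 : y <= 1.
  by case: (px) => _ <- _; rewrite (bigD1 v) //= lerDl sumr_ge0 // => *; exact: sqr_ge0.
have [->|yn1] := eqVneq y 1.
  by rewrite subrr mulr0 mulr1 mulr_ge0 // exprn_ge0.
have {yn1} yn1 : 0 < 1 - y by rewrite subr_gt0 lt_def y1 eq_sym yn1.
apply: (@le_trans _ _ ((l ^+ 2 - l' ^+ 2) * (1 - y))); first by rewrite ler_pM2r.
rewrite -(ler_pM2r yn1).
have sq : (l * (1 - 2 * y)) ^+ 2 <= (l' * (1 - y)) ^+ 2.
  by rewrite ler_pXn2r // nnegrE // mulr_ge0 // ltW.
have -> : (l ^+ 2 - l' ^+ 2) * (1 - y) * (1 - y) =
  l ^+ 2 * (1 - y) ^+ 2 - (l' * (1 - y)) ^+ 2 by ring.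
have le2 : l ^+ 2 * (1 - y) ^+ 2 - (l * (1 - 2 * y)) ^+ 2 <= 2 * l ^+ 2 * y * (1 - y).
  rewrite -subr_ge0.
  have -> : 2 * l ^+ 2 * y * (1 - y) -
     (l ^+ 2 * (1 - y) ^+ 2 - (l * (1 - 2 * y)) ^+ 2) = (l * y) ^+ 2 by ring.
  exact: sqr_ge0.
lra.
Qed.

(** Without an atom, cleaning makes all weighted degrees nearly 1/2; then codegrees along edges are
    small, the graph is bipartite, and [perron_bipartite] contradicts the bound on [vol]. *)
Lemma clean_has_atom (R : realType) (k t h : nat) (V : finType) (e : rel V)
    (l : R) (x : V -> R) :
  simple_graph e -> (2 <= k)%N -> F_free (@Kplus_rel k t) e ->
  (360 * 2 ^ (12 * k) * t.+1 <= h)%N ->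
  perron e l x ->
  (forall v, 29 / 30 * (\sum_(w | e v w) 1) * (1 - x v ^+ 2) <=
     2 * l ^+ 2 * x v ^+ 2) ->
  vol R e < 2 * l ^+ 2 ->
  exists v, 1 < x v ^+ 2 * h%:R.
Proof.
move=> ge k2 Ff hh px clean vl.
have [/existsP//|] := boolP [exists v, 1 < x v ^+ 2 * h%:R].
rewrite negb_exists => /forallP small; exfalso.
have {}small v : x v ^+ 2 * h%:R <= 1 by rewrite leNgt.
have y0 v : 0 <= x v ^+ 2 by exact: sqr_ge0.
have h30 : 30 <= h%:R :> R.
  rewrite ler_nat; apply: leq_trans hh.
  have : (0 < 2 ^ (12 * k))%N by rewrite expn_gt0.
  by set p := (2 ^ _)%N; nia.
have small30 v : x v ^+ 2 <= 1 / 30.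
  have : x v ^+ 2 * 30 <= 1 by apply: le_trans (small v); apply: ler_wpM2l.
  lra.
have [_ y1 _] := px.
have ydeg w z : e w z -> 7 / 15 <= \sum_(c | e w c) x c ^+ 2.
  move=> wz; have := clean w; have := perron_sqr_le w px.
  have : 1 <= \sum_(c | e w c) 1 :> R.
    by rewrite (bigD1 z) //= lerDl sumr_ge0.
  set d := \sum_(c | _) 1; set Y := \sum_(c | _) _ => d1 le1 le2.
  (* The degree cancels between cleaning and Cauchy-Schwarz. As no weight exceeds 1/30, the weighted
     degree is at least (29/30)^2 / 2 = 841/1800, just above 7/15 = 840/1800. *)
  have : d * (29 / 30 * (1 - x w ^+ 2)) <= d * (2 * Y) by lra.
  rewrite ler_pM2l; last by lra.
  by have := small30 w; lra.
have cod u v : e u v -> \sum_(c | e u c && e v c) x c ^+ 2 < 1 / 30.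
  exact: (@codegree_lt R k t h V e (fun v => x v ^+ 2) u v).
have [P Pbip] := bipartite_of_codegree ge y0 y1 ydeg cod.
by have := perron_bipartite (proj1 ge) px Pbip; rewrite leNgt vl.
Qed.

(** * Structure around an atom *)

Lemma card_heavy (R : realType) (V : finType) (e : rel V) (l : R) (x : V -> R)
    (A : {set V}) (c h : R) :
  perron e l x -> 0 < c -> 0 < h -> (forall v, v \in A -> 1 <= x v ^+ 2 * (h * c)) ->
  #|A|%:R <= h * c.
Proof.
move=> px c0 h0 xA; rewrite -(@sum1r_card R _ [in A]).
apply: (@le_trans _ _ (\sum_(v in A) x v ^+ 2 * (h * c))); first exact: ler_sum.
rewrite -mulr_suml ler_piMl ?(perron_le1 _ px) //.
by apply: ltW; rewrite mulr_gt0.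
Qed.

Section AtomStructure.
Variables (R : realType) (V : finType) (e : rel V) (l : R) (x : V -> R).
Variables (m h d d1 : R) (u0 : V).
Hypotheses (ge : simple_graph e) (px : perron e l x) (volE : vol R e = 2 * m).
Hypotheses (ml : m <= l ^+ 2) (xu0 : forall v, x v <= x u0).
Hypotheses (h0 : 0 < h) (xh : 1 <= x u0 ^+ 2 * h).
Hypotheses (d0 : 0 < d) (d1_gt0 : 0 < d1) (d1_le : d1 <= 1 / 2) (d_le : d <= 1 / 2).
Hypothesis (dm : (h * d ^- 2) ^+ 2 <= d * m).

Let X := x u0.
(** Two thresholds: [L] holds the entries that are not negligible, [A] those close to the maximum.
    Hypothesis [dm] makes the square of the size of [L] negligible against [m], so edges inside [L]
    do not matter. *)
Let L := [set v | d * X <= x v].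
Let A := [set v | (1 - d1) * X <= x v].
Let B := [set v | (v \notin L) && [forall u in A, e u v]].

Let x_ge0 v : 0 <= x v. Proof. by case: px. Qed.
Let m0 : 0 <= m.
Proof.
have : 0 <= d * m by apply: le_trans dm; exact: sqr_ge0.
by rewrite pmulr_rge0.
Qed.
Let X0 : 0 < X.
Proof.
rewrite lt_def x_ge0 andbT; apply/eqP => X0.
by move: xh; rewrite -/X X0 expr0n mul0r ler10.
Qed.
Let AL : A \subset L.
Proof.
apply/subsetP => v; rewrite !inE; apply: le_trans.
by rewrite ler_pM2r //; move: d1_le d_le; lra.
Qed.

Lemma card_atoms_le : #|A|%:R <= 4 * h.
Proof.
rewrite mulrC; apply: (card_heavy px) => // v; rewrite inE => xv.
have le : (X / 2) ^+ 2 <= x v ^+ 2.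
  rewrite ler_pXn2r ?nnegrE ?divr_ge0 ?(ltW X0) //.
  by apply: le_trans xv; rewrite mulrC ler_pM2r //; move: d1_le; lra.
have : (X / 2) ^+ 2 * (h * 4) <= x v ^+ 2 * (h * 4) by rewrite ler_pM2r ?mulr_gt0.
by move: xh; rewrite -/X; lra.
Qed.

Let nL2 : #|L|%:R ^+ 2 <= d * m :> R.
Proof.
apply: le_trans dm; rewrite ler_pXn2r ?nnegrE //.
  apply: (card_heavy px) => // [|v]; first by rewrite invr_gt0 exprn_gt0.
  rewrite inE => xv; rewrite mulrCA mulrA.
  have : (d * X) ^+ 2 <= x v ^+ 2.
    by rewrite ler_pXn2r ?nnegrE ?mulr_ge0 ?(ltW X0) ?(ltW d0).
  rewrite exprMn => le; rewrite ler_pdivlMr ?exprn_gt0 // mul1r.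
  have : d ^+ 2 * 1 <= d ^+ 2 * (X ^+ 2 * h) by rewrite ler_pM2l ?exprn_gt0.
  rewrite mulr1 => le2; apply: le_trans le2 _; rewrite mulrA (mulrC h).
  by rewrite ler_pM2r.
by rewrite mulr_ge0 ?(ltW h0) // invr_ge0 exprn_ge0 // ltW.
Qed.

Let G v := \sum_(w | (w \in L) && e v w) x w.
Let g v : R := \sum_(w | (w \in L) && e v w) 1.
Let N := \sum_(v | v \notin L) g v.

Let g0 v : 0 <= g v. Proof. exact: sumr_ge0. Qed.
Let GX v : G v <= X * g v.
Proof. by rewrite mulr_sumr; apply: ler_sum => w _; rewrite mulr1 xu0. Qed.

(** Expand by the walks [u], [v], [w]. Those ending outside [L] contribute at most 2[m] entries
    below [d * X], those with [v] and [w] in [L] at most [d * m * X]; the others pass through the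
    complement of [L] and end in [L]. *)
Let two_walks u :
  l ^+ 2 * x u <= \sum_(v | (v \notin L) && e u v) G v + 3 * d * m * X.
Proof.
case: (px) => _ _ ex.
rewrite expr2 -mulrA ex mulr_sumr.
under eq_bigr do rewrite ex (bigID [in L]) /=.
rewrite big_split /=.
have -> : \sum_(v | e u v) \sum_(w | e v w && (w \in L)) x w = \sum_(v | e u v) G v.
  by apply: eq_bigr => v _; apply: eq_bigl => w; rewrite andbC.
have le1 : \sum_(v | e u v) \sum_(w | e v w && (w \notin L)) x w <= 2 * m * (d * X).
  rewrite -volE /vol mulr_suml.
  apply: (@le_trans _ _ (\sum_(v | e u v) (\sum_(w | e v w) 1) * (d * X))).
    apply: ler_sum => v _; rewrite mulr_suml.
    apply: (@le_trans _ _ (\sum_(w | e v w && (w \notin L)) 1 * (d * X))).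
      by apply: ler_sum => w /andP[_]; rewrite inE -ltNge mul1r => /ltW.
    by apply: ler_psum => [w /andP[]//|w _]; rewrite mul1r mulr_ge0 // ltW.
  by apply: ler_psum => // v _; rewrite mulr_ge0 ?sumr_ge0 // mulr_ge0 // ltW.
have le2 : \sum_(v | e u v) G v <=
    \sum_(v | (v \notin L) && e u v) G v + #|L|%:R ^+ 2 * X.
  rewrite (bigID [in L]) /= addrC.
  rewrite [X in X + _](eq_bigl (fun v => (v \notin L) && e u v)); last first.
    by move=> v; rewrite andbC.
  rewrite lerD2l.
  apply: (@le_trans _ _ (\sum_(v in L) #|L|%:R * X)).
    apply: (@le_trans _ _ (\sum_(v | e u v && (v \in L)) #|L|%:R * X)).
      apply: ler_sum => v _; apply: le_trans (GX v) _.
      rewrite mulrC ler_pM2r // -(@sum1r_card R _ [in L]).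
      by apply: ler_psum => // w /andP[].
    by apply: ler_psum => [v /andP[]//|v _]; rewrite mulr_ge0 // ltW.
  by rewrite sumr_const -[leLHS]mulr_natl mulrA expr2.
have le3 : #|L|%:R ^+ 2 * X <= d * m * X by rewrite ler_pM2r.
lra.
Qed.

Let N_le : N <= m.
Proof.
suff : 2 * N <= vol R e by rewrite volE; lra.
rewrite /vol (bigID [in L]) /= addrC mulr2n mulrDl mul1r; apply: lerD.
  by apply: ler_sum => v _; apply: ler_psum => // w /andP[].
rewrite /N (exchange_big_dep [in L]) /=; last by move=> ? ? _ /andP[].
apply: ler_sum => v vL; apply: ler_psum => // w /andP[_ /andP[_]].
by case: ge => es _; rewrite es.
Qed.

(** Since [x u] is nearly maximal, [two_walks] forces almost [m] edges between [L] and the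
    neighbours of [u] outside [L], while at most [m] edges join [L] to its complement. *)
Let missed u : u \in A ->
  \sum_(v | (v \notin L) && ~~ e u v) g v <= (d1 + 3 * d) * m.
Proof.
rewrite inE => xu.
have le1 := two_walks u.
have le2 : \sum_(v | (v \notin L) && e u v) G v <=
    X * \sum_(v | (v \notin L) && e u v) g v.
  by rewrite mulr_sumr; apply: ler_sum.
have le3 : m * ((1 - d1) * X) <= l ^+ 2 * x u.
  by apply: ler_pM => //; rewrite mulr_ge0 ?(ltW X0) //; move: d1_le; lra.
have : N = \sum_(v | (v \notin L) && e u v) g v +
           \sum_(v | (v \notin L) && ~~ e u v) g v.
  by rewrite /N (bigID (e u)).
move: le1 le2 le3; set a := \sum_(v | _) G v; set b := \sum_(v | _) g v.
set c := \sum_(v | _) g v => le1 le2 le3 NE.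
have : X * ((1 - d1 - 3 * d) * m) <= X * b by lra.
by rewrite ler_pM2l //; move: N_le; lra.
Qed.

Lemma atom_bipartite :
  (1 - 3 * d - 3 * d / d1 - #|A|%:R * (d1 + 3 * d)) * m <= #|A|%:R * #|B|%:R.
Proof.
pose ga v : R := \sum_(w | (w \in A) && e v w) 1.
have gag v : ga v <= g v.
  by apply: ler_psum => // w /andP[/(subsetP AL) -> ->].
have le1 : m * X <= \sum_(v | v \notin L) G v + 3 * d * m * X.
  apply: (@le_trans _ _ (l ^+ 2 * X)); first by rewrite ler_pM2r.
  apply: le_trans (two_walks u0) _; rewrite lerD2r.
  apply: ler_psum => [v /andP[]//|v _]; exact: sumr_ge0.
have le2 : \sum_(v | v \notin L) G v <= X * N by rewrite mulr_sumr; apply: ler_sum.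
(* An edge ending in [L] but not in [A] falls short of [X] by at least [d1 * X]; as the total
   shortfall is small, few edges do so. *)
have le3 : d1 * X * (N - \sum_(v | v \notin L) ga v) <=
    X * N - \sum_(v | v \notin L) G v.
  rewrite -sumrB !mulr_sumr -sumrB; apply: ler_sum => v _.
  rewrite /g /ga /G mulr_sumr -sumrB (bigID [in A]) /=.
  rewrite [X in X + _ - _](eq_bigl (fun w => (w \in A) && e v w)); last first.
    move=> w; case wA: (w \in A); rewrite ?andbF ?andbT //.
    by rewrite (subsetP AL _ wA).
  rewrite addrAC subrr add0r mulr_sumr.
  apply: (@le_trans _ _ (\sum_(w | [&& w \in L, e v w & w \notin A]) (X * 1 - x w))).
    rewrite [leLHS](eq_bigl (fun w => [&& w \in L, e v w & w \notin A])).
      by apply: ler_sum => w /and3P[_ _]; rewrite inE -ltNge; lra.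
    by move=> w; rewrite andbA.
  apply: ler_psum => [w /and3P[-> ->]//|w _].
  by rewrite mulr1 subr_ge0 xu0.
(* A vertex outside [L] and [B] is not adjacent to some [u] in [A], and its edges are charged to
   [missed u]. *)
have le4 : \sum_(v | v \notin L) ga v <=
    #|A|%:R * #|B|%:R + #|A|%:R * ((d1 + 3 * d) * m).
  rewrite (bigID [in B]) /=; apply: lerD.
    rewrite -[X in _ * X](@sum1r_card R _ [in B]) mulr_sumr.
    apply: (@le_trans _ _ (\sum_(v | (v \notin L) && (v \in B)) #|A|%:R * 1)).
      apply: ler_sum => v _; rewrite mulr1 -(@sum1r_card R _ [in A]).
      by apply: ler_psum => // w /andP[].
    by apply: ler_psum => [v /andP[]//|v _]; rewrite mulr1.
  apply: (@le_trans _ _ (\sum_(u in A) \sum_(v | (v \notin L) && ~~ e u v) g v)).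
    rewrite [leRHS](exchange_big_dep (fun v => v \notin L)) /=; last by move=> ? ? _ /andP[].
    apply: (@le_trans _ _ (\sum_(v | (v \notin L) && (v \notin B)) g v)).
      exact: ler_sum.
    rewrite (bigID [in B] (fun v => v \notin L)) /= -[leLHS]add0r; apply: lerD.
      by apply: sumr_ge0 => v _; apply: sumr_ge0.
    apply: ler_sum => v /andP[vL]; rewrite inE vL /=.
    move=> /forallPn[u]; rewrite negb_imply => /andP[uA uv].
    by rewrite (bigD1 u) /= ?uA ?vL ?uv // lerDl sumr_ge0.
  rewrite -(@sum1r_card R _ [in A]) mulr_suml; apply: ler_sum => u uA.
  by rewrite mul1r missed.
have Ngt : X * ((1 - 3 * d) * m) <= X * N by lra.
rewrite ler_pM2l // in Ngt.
have : d1 * X * (N - \sum_(v | v \notin L) ga v) <= X * (3 * d * m).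
  have := N_le; rewrite -(ler_pM2l X0) => NX; lra.
rewrite mulrAC mulrC ler_pM2l // -ler_pdivlMl //.
move: le4; set a := #|A|%:R; set S := \sum_(v | _) ga v => le4 le5.
have -> : 3 * d / d1 = d1^-1 * (3 * d) by rewrite mulrC.
lra.
Qed.

End AtomStructure.

(** The edges at [v] are distinct from those between [A] and [B], which the degree sum counts
    twice. *)
Lemma deg_outside_le (R : realType) (V : finType) (e : rel V) (A B : {set V}) v :
  symmetric e -> [disjoint A & B] -> (forall a b, a \in A -> b \in B -> e a b) ->
  v \notin A -> v \notin B ->
  (\sum_(w | e v w) 1) + 2 * (#|A|%:R * #|B|%:R) <= vol R e.
Proof.
move=> es dAB eAB vA vB.
rewrite /vol [leRHS](bigD1 v) //= lerD2l [leRHS](bigID [in A]) /= mulr2n mulrDl mul1r.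
have part (C D : {set V}) (P : pred V) : (forall c, c \in C -> P c) ->
    (forall c a, c \in C -> a \in D -> e c a) ->
    #|C|%:R * #|D|%:R <= \sum_(c | P c) \sum_(w | e c w) 1 :> R.
  move=> CP CD; rewrite -(@sum1r_card R _ [in C]) mulr_suml.
  apply: (@le_trans _ _ (\sum_(c in C) \sum_(w | e c w) 1)).
    apply: ler_sum => c cC; rewrite mul1r -(@sum1r_card R _ [in D]).
    by apply: ler_psum => // a aD; exact: CD.
  by apply: ler_psum => // c _; exact: sumr_ge0.
apply: lerD.
  by apply: part => // c cA; rewrite cA andbT; apply: contraNneq vA => <-.
rewrite [leLHS]mulrC; apply: part => [c cB|c a cB aA]; last by rewrite es eAB.
rewrite (contraNneq _ vB) => [|<- //]; apply/negP => cA.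
by move/pred0P/(_ c): dAB; rewrite /= cA cB.
Qed.

Lemma atom_structure (h D : nat) : (0 < h)%N -> (1 < D)%N ->
  exists m0 : nat, forall (m : nat), (m0 <= m)%N ->
  forall (R : realType) (V : finType) (e : rel V) (l : R) (x : V -> R),
  simple_graph e -> perron e l x -> vol R e = 2 * m%:R -> m%:R <= l ^+ 2 ->
  (exists v, 1 <= x v ^+ 2 * h%:R) ->
  exists (A B : {set V}) (X : R),
    [/\ (0 < #|A|)%N /\ (#|A| <= 4 * h)%N, 0 < X, forall v, x v <= X,
      forall v, v \in A -> (1 - D%:R^-1) * X <= x v &
      [/\ forall v, v \notin A -> x v <= D%:R^-1 * X,
        forall a b, a \in A -> b \in B -> e a b &
        (1 - D%:R^-1) * m%:R <= #|A|%:R * #|B|%:R :> R]].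
Proof.
(* 1/[E] is the relative error allowed in the number of edges between [A] and [B]. With [d = 1/K],
   the threshold [h ^ 2 * K ^ 5] is exactly hypothesis [dm] of the section above. *)
move=> h1 D2; pose E := (2 * D ^ 2 * h)%N; pose K := (84 * h * E ^ 2)%N.
exists (h ^ 2 * K ^ 5)%N => m hm R V e l x ge px volE ml [v1 xv1].
have E1 : (0 < E)%N by rewrite /E !muln_gt0 h1 ?expn_gt0; lia.
have K1 : (0 < K)%N.
  by rewrite /K (muln_gt0 (84 * h)) (muln_gt0 84) (expn_gt0 E) E1 h1.
have hR : 0 < h%:R :> R by rewrite ltr0n.
have hR1 : 1 <= h%:R :> R by rewrite ler1n.
have DR : 2 <= D%:R :> R by rewrite ler_nat.
have ER : 0 < E%:R :> R by rewrite ltr0n.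
have ER1 : 1 <= E%:R :> R by rewrite ler1n.
have EE : E%:R = 2 * D%:R ^+ 2 * h%:R :> R.
  by rewrite /E (natrM _ (2 * D ^ 2)) (natrM _ 2) natrX.
have KE : K%:R = 84 * h%:R * E%:R ^+ 2 :> R.
  by rewrite /K (natrM _ (84 * h)) (natrM _ 84) (natrX _ E).
have KR : 0 < K%:R :> R by rewrite ltr0n.
(* As [A] has at most 4[h] elements, [d1] costs at most 1/(4[E]) in [atom_bipartite]; the terms in
   [d] add up to at most 63 [h * E * d] = 3/(4[E]). *)
pose d1 : R := (16 * h%:R * E%:R)^-1.
pose d : R := K%:R^-1.
have mR : 1 <= m%:R :> R.
  by rewrite ler1n; apply: leq_trans hm; rewrite (muln_gt0 (h ^ 2)) (expn_gt0 K) (expn_gt0 h) h1 K1.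
have [u0 _ u0max] := @Order.TotalTheory.arg_maxP _ _ _ v1 predT x isT.
have {}u0max v : x v <= x u0 by exact: u0max.
have x0 v : 0 <= x v by case: px.
have xu0 : 1 <= x u0 ^+ 2 * h%:R.
  by apply: le_trans xv1 _; rewrite ler_pM2r // ler_pXn2r ?nnegrE.
have d1_gt0 : 0 < d1 by rewrite invr_gt0 !mulr_gt0.
have d0 : 0 < d by rewrite invr_gt0.
have Dh : D%:R <= 16 * h%:R * E%:R :> R.
  rewrite -mulrA -[leLHS]mul1r; apply: ler_pM => //; first by lra.
  rewrite -[leLHS]mul1r; apply: ler_pM => //.
  by rewrite EE; nra.
have d1D : d1 <= D%:R^-1 by rewrite lef_pV2 ?posrE //; nra.
have Dinv : D%:R^-1 <= 1 / 2 :> R by rewrite div1r lef_pV2 ?posrE; lra.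
have DK : D%:R <= K%:R :> R.
  rewrite KE; apply: le_trans Dh _.
  rewrite expr2 mulrA ler_pM2r // -[leLHS]mulr1; apply: ler_pM => //; try lra.
have dD : d <= D%:R^-1 by rewrite lef_pV2 ?posrE //; lra.
have dm : (h%:R * d ^- 2) ^+ 2 <= d * m%:R.
  rewrite /d exprVn invrK [leRHS]mulrC ler_pdivlMr //.
  have : (h ^ 2 * K ^ 5)%:R <= m%:R :> R by rewrite ler_nat.
  rewrite (natrM _ (h ^ 2)) (natrX _ h) (natrX _ K) => le; apply: le_trans le.
  by rewrite le_eqVlt; apply/orP; left; apply/eqP; ring.
have cA := @card_atoms_le R V e l x h%:R d1 u0 px hR xu0.
have cB := @atom_bipartite R V e l x m%:R h%:R d d1 u0 ge px volE ml u0max hR xu0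
  d0 d1_gt0 _ _ dm.
set X := x u0; set A := [set v | (1 - d1) * X <= x v] in cA cB *.
set L := [set v | d * X <= x v] in cB.
set B := [set v | _ && _] in cB *.
have {}cA : #|A|%:R <= 4 * h%:R :> R by apply: cA => //; lra.
have {}cB : (1 - E%:R^-1) * m%:R <= #|A|%:R * #|B|%:R :> R.
  apply: le_trans (cB _ _); rewrite ?ler_pM2r; try lra.
  have e1 : 4 * h%:R * d1 = (4 * E%:R)^-1.
    by rewrite /d1; field; rewrite !gt_eqF.
  have e2 : 3 * d / d1 = 48 * h%:R * E%:R * d.
    by rewrite /d1; field; rewrite !gt_eqF.
  have e3 : 63 * h%:R * E%:R * d = 3 * (4 * E%:R)^-1.
    by rewrite /d KE; field; rewrite !gt_eqF.
  have e4 : (4 * E%:R)^-1 * 4 = E%:R^-1 :> R by field; rewrite gt_eqF.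
  have e5 : #|A|%:R * (d1 + 3 * d) <= 4 * h%:R * (d1 + 3 * d).
    by rewrite ler_pM2r //; lra.
  have hE : h%:R * d <= h%:R * E%:R * d.
    by rewrite ler_pM2r // -[leLHS]mulr1 ler_pM2l.
  have hE' : d <= h%:R * d by rewrite -[leLHS]mul1r ler_pM2r.
  rewrite e2; lra.
have X0 : 0 < X.
  rewrite lt_def x0 andbT; apply/eqP => X0.
  by move: xu0; rewrite -/X X0 expr0n mul0r ler10.
have eAB a b : a \in A -> b \in B -> e a b.
  by move=> aA; rewrite inE => /andP[_ /forallP/(_ a)]; rewrite aA.
have dAB : [disjoint A & B].
  apply/pred0P => v /=; apply/negP => /andP[]; rewrite !inE => vA /andP[/negP vL _].
  by apply: vL; apply: le_trans vA; rewrite ler_pM2r //; lra.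
exists A, B, X; split => //.
- split; last by rewrite -(ler_nat R) natrM.
  by apply/card_gt0P; exists u0; rewrite inE -/X; nra.
- by move=> v; rewrite inE => vA; apply: le_trans vA; rewrite ler_pM2r //; lra.
- split => //; last first.
    apply: le_trans cB; rewrite ler_pM2r; last lra.
    have : E%:R^-1 <= D%:R^-1 :> R; last lra.
    rewrite lef_pV2 ?posrE //; last lra.
    rewrite EE; nra.
  (* A vertex of [B] lies outside [L]. Any other has degree at most 2[m]/[E], so its weight is at
     most 2/[E], which is 1/([D]^2 [h]) and hence at most [X]^2/[D]^2. *)
  move=> v vA; have [vB|vB] := boolP (v \in B).
    move: (vB); rewrite !inE -ltNge => /andP[/ltW xv _].
    by apply: le_trans xv _; rewrite ler_pM2r.
  have := deg_outside_le R (proj1 ge) dAB eAB vA vB.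
  have := perron_sqr_le_deg v px; set dv := \sum_(w | _) 1 => h2 h3.
  have h4 : l ^+ 2 * x v ^+ 2 <= l ^+ 2 * (2 * E%:R^-1).
    apply: (@le_trans _ _ (m%:R * (2 * E%:R^-1))).
      by move: volE h3 cB h2; lra.
    by rewrite ler_pM2r // mulr_gt0 // invr_gt0.
  rewrite ler_pM2l in h4; last by lra.
  rewrite -(@ler_pXn2r _ 2) // ?nnegrE ?mulr_ge0 ?invr_ge0 ?(ltW X0) //.
  apply: le_trans h4 _; rewrite exprMn EE.
  have -> : 2 * (2 * D%:R ^+ 2 * h%:R)^-1 = D%:R^-1 ^+ 2 * h%:R^-1 :> R.
    by field; rewrite !gt_eqF //; lra.
  rewrite ler_pM2l ?exprn_gt0 ?invr_gt0 //; last lra.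
  by rewrite -[leLHS]mul1r ler_pdivrMr.
Qed.

(** * The eigenvalue equation restricted to the atoms *)

(** The eigenvalue equation is applied first at the vertices of [A], then at the outer vertices
    adjacent to them. *)
Lemma perron_split (R : realType) (V : finType) (e : rel V) (l : R) (x : V -> R)
    (A : {set V}) :
  symmetric e -> perron e l x ->
  l ^+ 2 * \sum_(p in A) x p ^+ 2 =
    l * \sum_(p in A) \sum_(q | (q \in A) && e p q) x p * x q +
    \sum_(v | v \notin A) (\sum_(p | (p \in A) && e v p) x p) ^+ 2 +
    \sum_(v | v \notin A) (\sum_(w | (w \notin A) && e v w) x w) *
                          (\sum_(p | (p \in A) && e v p) x p).
Proof.
move=> es [_ _ ex].
have exA v : l * x v = \sum_(p | (p \in A) && e v p) x p +
    \sum_(w | (w \notin A) && e v w) x w.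
  by rewrite ex (bigID [in A]) /=; congr (_ + _); apply: eq_bigl => w; rewrite andbC.
have -> : l ^+ 2 * \sum_(p in A) x p ^+ 2 = l * \sum_(p in A) x p * (l * x p).
  rewrite expr2 -mulrA [in RHS]mulr_sumr mulr_sumr mulr_sumr.
  by apply: eq_bigr => p _; ring.
under eq_bigr do rewrite exA mulrDr.
rewrite big_split /= mulrDr -addrA; congr (_ + _).
  by congr (_ * _); apply: eq_bigr => p _; rewrite mulr_sumr.
rewrite -big_split /=.
have -> : \sum_(p in A) x p * (\sum_(w | (w \notin A) && e p w) x w) =
    \sum_(v | v \notin A) x v * \sum_(p | (p \in A) && e v p) x p.
  under eq_bigr do rewrite mulr_sumr.
  rewrite (exchange_big_dep (fun v => v \notin A)) /=; last by move=> ? ? _ /andP[].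
  apply: eq_bigr => v vA; rewrite mulr_sumr; apply: eq_big => [p|p _].
    by rewrite vA es.
  by rewrite mulrC.
rewrite mulr_sumr; apply: eq_bigr => v _; rewrite mulrA exA; ring.
Qed.

Section SplitBound.
Variables (R : realType) (V : finType) (e : rel V) (l : R) (x : V -> R).
Variables (A : {set V}) (X d : R).
Hypotheses (ge : simple_graph e) (px : perron e l x).
Hypotheses (X0 : 0 < X) (xX : forall v, x v <= X).
Hypotheses (xA : forall v, v \in A -> (1 - d) * X <= x v).
Hypotheses (xT : forall v, v \notin A -> x v <= d * X) (d_le : d <= 1 / 8).

Let yA := \sum_(p in A) x p ^+ 2.
Let QA := \sum_(p in A) \sum_(q | (q \in A) && e p q) x p * x q.
Let x_ge0 v : 0 <= x v. Proof. by case: px. Qed.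

Lemma weight_ge : #|A|%:R * (49 / 64 * X ^+ 2) <= yA.
Proof.
rewrite -(@sum1r_card R _ [in A]) mulr_suml; apply: ler_sum => p /xA xp.
have : (7 / 8 * X) ^+ 2 <= x p ^+ 2.
  have X78 : 0 <= 7 / 8 * X by move: X0; lra.
  rewrite ler_pXn2r ?nnegrE //.
  by apply: le_trans xp; rewrite ler_pM2r //; move: d_le; lra.
by lra.
Qed.

Lemma cross_term_le :
  \sum_(v | v \notin A) (\sum_(w | (w \notin A) && e v w) x w) *
                        (\sum_(p | (p \in A) && e v p) x p) <=
  (\sum_(v | v \notin A) \sum_(w | (w \notin A) && e v w) 1) *
  (d * X) * (#|A|%:R * X).
Proof.
rewrite -mulrA mulr_suml; apply: ler_sum => v _; rewrite mulrA.
apply: ler_pM; rewrite ?sumr_ge0 //.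
  by rewrite mulr_suml; apply: ler_sum => w /andP[/xT]; rewrite mul1r.
rewrite -(@sum1r_card R _ [in A]) mulr_suml.
apply: (@le_trans _ _ (\sum_(p | (p \in A) && e v p) 1 * X)).
  by apply: ler_sum => p _; rewrite mul1r.
by apply: ler_psum => [p /andP[]//|p _]; rewrite mul1r ltW.
Qed.

Lemma vol_split :
  vol R e = \sum_(p in A) \sum_(q | (q \in A) && e p q) 1 +
    2 * \sum_(v | v \notin A) (\sum_(p | (p \in A) && e v p) 1) +
    \sum_(v | v \notin A) \sum_(w | (w \notin A) && e v w) 1.
Proof.
have spl v : \sum_(w | e v w) 1 = \sum_(p | (p \in A) && e v p) 1 +
    \sum_(w | (w \notin A) && e v w) 1 :> R.
  by rewrite (bigID [in A]) /=; congr (_ + _); apply: eq_bigl => w; rewrite andbC.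
rewrite /vol (bigID [in A]) /=.
under eq_bigr do rewrite spl.
under [X in _ + X]eq_bigr do rewrite spl.
rewrite !big_split /=.
have -> : \sum_(p in A) (\sum_(w | (w \notin A) && e p w) 1) =
    \sum_(v | v \notin A) \sum_(p | (p \in A) && e v p) 1 :> R.
  rewrite (exchange_big_dep (fun v => v \notin A)) /=; last by move=> ? ? _ /andP[].
  apply: eq_bigr => v vA; apply: eq_bigl => p.
  by case: ge => es _; rewrite vA es.
ring.
Qed.

(** Each edge is charged at most [yA]: by Cauchy-Schwarz an outer vertex with j neighbours in [A]
    contributes at most j [yA], and the smallness of [d] lets each ordered pair of adjacent outer
    vertices cost at most [yA]/2. *)
Lemma split_le (m : R) : vol R e = 2 * m -> l ^+ 2 * yA <= l * QA + m * yA.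
Proof.
move=> volE; rewrite (perron_split A (proj1 ge) px) -/QA -addrA lerD2l.
move: volE; rewrite vol_split.
set W := \sum_(p in A) _; set J := \sum_(v | _) \sum_(p | _) 1.
set F := \sum_(v | _) \sum_(w | _) 1 => volE.
have W0 : 0 <= W by apply: sumr_ge0 => *; apply: sumr_ge0.
have F0 : 0 <= F by apply: sumr_ge0 => *; apply: sumr_ge0.
have yA0 : 0 <= yA by apply: sumr_ge0 => *; exact: sqr_ge0.
have le1 : \sum_(v | v \notin A) (\sum_(p | (p \in A) && e v p) x p) ^+ 2 <= J * yA.
  rewrite mulr_suml; apply: ler_sum => v _; apply: le_trans (sum_sqr_le _ _) _.
  apply: ler_wpM2l; first exact: sumr_ge0.
  by apply: ler_psum => [p /andP[]//|p _]; exact: sqr_ge0.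
have le2 := cross_term_le; rewrite -/F in le2.
have le3 : F * (d * X) * (#|A|%:R * X) <= F * (yA / 2).
  rewrite -mulrA; apply: ler_wpM2l => //.
  have := weight_ge; have : 0 <= #|A|%:R * X ^+ 2 * (1 / 8 - d).
    by rewrite mulr_ge0 ?subr_ge0 // mulr_ge0 // sqr_ge0.
  have : 0 <= #|A|%:R * X ^+ 2 by rewrite mulr_ge0 // sqr_ge0.
  set z := #|A|%:R * X ^+ 2.
  have -> : #|A|%:R * (49 / 64 * X ^+ 2) = 49 / 64 * z by rewrite /z; ring.
  have -> : d * X * (#|A|%:R * X) = d * z by rewrite /z; ring.
  lra.
have le4 : (J + F / 2) * yA <= m * yA by apply: ler_wpM2r => //; lra.
lra.
Qed.

Lemma clique_sum : \sum_(p in A) \sum_(q | (q \in A) && (q != p)) x p * x q =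
  (\sum_(p in A) x p) ^+ 2 - yA.
Proof.
rewrite expr2 mulr_suml -sumrB; apply: eq_bigr => p pA.
by rewrite [in RHS](bigD1 p) //= mulrDr expr2 addrAC subrr add0r mulr_sumr.
Qed.

Lemma quad_inside_le : QA <= (#|A|%:R - 1) * yA.
Proof.
apply: (@le_trans _ _ ((\sum_(p in A) x p) ^+ 2 - yA)).
  rewrite -clique_sum; apply: ler_sum => p pA; apply: ler_psum => [q /andP[-> pq]|q _].
    by apply: contraTneq pq => ->; case: ge => _ ->.
  exact: mulr_ge0.
have := sum_sqr_le [in A] x; rewrite sum1r_card -/yA; lra.
Qed.

Lemma quad_inside_nonclique p0 q0 : p0 \in A -> q0 \in A -> p0 != q0 -> ~~ e p0 q0 ->
  QA <= (#|A|%:R - 1) * yA - 49 / 64 * X ^+ 2.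
Proof.
move=> pA qA pq npq.
have h1 : QA + x p0 * x q0 <= (\sum_(p in A) x p) ^+ 2 - yA.
  rewrite -clique_sum /QA (bigD1 p0) //= addrAC [leRHS](bigD1 p0) //=; apply: lerD.
    rewrite [leRHS](bigD1 q0) /=; last by rewrite qA eq_sym.
    rewrite addrC lerD2l; apply: ler_psum => [q /andP[-> pq0]|q _].
      rewrite /=; apply/andP; split; last by apply: contraTneq pq0 => ->.
      by apply: contraTneq pq0 => ->; case: ge => _ ->.
    exact: mulr_ge0.
  apply: ler_sum => p _; apply: ler_psum => [q /andP[-> pq1]|q _].
    by apply: contraTneq pq1 => ->; case: ge => _ ->.
  exact: mulr_ge0.
have h2 : (7 / 8 * X) * (7 / 8 * X) <= x p0 * x q0.
  have X78 : 0 <= 7 / 8 * X by move: X0; lra.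
  by apply: ler_pM => //; [apply: le_trans (xA pA)|apply: le_trans (xA qA)];
    rewrite ler_pM2r //; move: d_le; lra.
have := sum_sqr_le [in A] x; rewrite sum1r_card -/yA; lra.
Qed.

Lemma weight_le : yA <= #|A|%:R * X ^+ 2.
Proof.
rewrite -(@sum1r_card R _ [in A]) mulr_suml; apply: ler_sum => p _.
by rewrite mul1r ler_pXn2r ?nnegrE // ltW.
Qed.

End SplitBound.

Lemma card_setD2_ge (V : finType) (A : {set V}) (p q : V) (k : nat) :
  (k < #|A|)%N -> (k.-1 <= #|A :\: [set p; q]|)%N.
Proof.
move=> kA; rewrite cardsD; have := subset_leq_card (subsetIr A [set p; q]).
by rewrite cards2; case: (p != q) => /=; lia.
Qed.

(** By [split_le], [QA <= c * yA] implies [l ^+ 2 <= l * c + m]. Fewer than k atoms give c = k - 2,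
    too small for the lower bound on [l]. With more than k, an edge inside [A] with k - 1 further
    atoms and [B] yields the forbidden graph, so c = 0, against [m < l ^+ 2]. *)
Lemma atom_is_clique (k t : nat) (R : realType) (V : finType) (e : rel V) (l : R)
    (x : V -> R) (A B : {set V}) (X d m : R) :
  simple_graph e -> perron e l x -> 0 < X -> (forall v, x v <= X) ->
  (forall v, v \in A -> (1 - d) * X <= x v) ->
  (forall v, v \notin A -> x v <= d * X) -> d <= 1 / 8 ->
  (2 <= k)%N -> F_free (@Kplus_rel k t) e -> (0 < #|A|)%N -> (t < #|B|)%N ->
  (forall a b, a \in A -> b \in B -> e a b) ->
  vol R e = 2 * m -> m < l ^+ 2 -> m - k%:R ^+ 2 <= l ^+ 2 - (k%:R - 1) * l ->
  2 * k%:R ^+ 3 < l ->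
  [/\ #|A| = k, forall p q, p \in A -> q \in A -> p != q -> e p q &
      l ^+ 2 - (k%:R - 1) * l <= m].
Proof.
move=> ge px X0 xX xA xT d_le k2 Ff A0 tB eAB volE ml lk klt.
have kR : 2 <= k%:R :> R by rewrite ler_nat.
have k3 : k%:R ^+ 2 * 4 <= 2 * k%:R ^+ 3 :> R.
  have -> : 2 * k%:R ^+ 3 = k%:R ^+ 2 * (2 * k%:R) :> R by ring.
  by rewrite ler_pM2l ?exprn_gt0; lra.
have l0 : 0 < l by apply: le_lt_trans klt; rewrite mulr_ge0 // exprn_ge0.
have main := split_le ge px X0 xX xA xT d_le volE.
have yge := weight_ge px X0 xA d_le; have yle := weight_le A px X0 xX.
have Q1 := quad_inside_le A ge px.
have Q2 := quad_inside_nonclique ge px X0 xA d_le.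
set yA := \sum_(p in A) x p ^+ 2 in main yge yle Q1 Q2.
set QA := \sum_(p in A) _ in main Q1 Q2.
have y0 : 0 < yA.
  apply: lt_le_trans yge; rewrite mulr_gt0 ?ltr0n // mulr_gt0 // ?exprn_gt0 //.
  lra.
have bound c : QA <= c * yA -> l ^+ 2 <= l * c + m.
  move=> Qc; rewrite -(ler_pM2r y0); apply: le_trans main _.
  by rewrite mulrDl lerD2r -mulrA ler_pM2l.
have [Ak|kA|Ak] := ltngtP #|A| k.
- exfalso; have A1 : #|A|%:R - 1 <= k%:R - 2 :> R.
    have : (#|A|%:R + 1) <= k%:R :> R by rewrite natr1 ler_nat.
    lra.
  have : l ^+ 2 <= l * (k%:R - 2) + m.
    by apply: bound; apply: le_trans Q1 _; rewrite ler_pM2r.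
  by have := sqr_ge0 (k%:R : R); lra.
- exfalso; have QA0 : QA <= 0 * yA.
    rewrite mul0r /QA big1 // => p pA; rewrite big1 // => q /andP[qA pq].
    exfalso; apply: Ff; apply: (@Kplus_subgraph k t V e p q (A :\: [set p; q]) B) => //.
    + exact: ltnW k2.
    + exact: card_setD2_ge.
    + by rewrite !inE eqxx.
    + by rewrite !inE eqxx orbT.
    + by move=> b bB; rewrite !eAB.
    + by move=> w b; rewrite !inE => /andP[_ wA] bB; apply: eAB.
  by have := bound _ QA0; rewrite mulr0 add0r leNgt ml.
rewrite Ak in Q1 Q2 yle.
split => //; last by have := bound _ Q1; lra.
move=> p q pA qA pq; apply/negPn/negP => npq.
have := Q2 _ _ pA qA pq npq => Q3.
(* Since [yA] is at most k [X]^2, a missing pair costs 49/64 [l]/k, more than the available k^2 once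
   [l] exceeds 2k^3. *)
have : l ^+ 2 <= l * (k%:R - 1 - 49 / 64 / k%:R) + m.
  apply: bound; apply: le_trans Q3 _.
  have : 49 / 64 / k%:R * yA <= 49 / 64 * X ^+ 2; last lra.
  by rewrite mulrAC ler_pdivrMr; lra.
rewrite mulrBr => h1.
have h2 : l * (49 / 64 / k%:R) <= k%:R ^+ 2 by lra.
have h3 : l * (49 / 64) <= k%:R ^+ 3.
  by move: h2; rewrite mulrA ler_pdivrMr -?exprSr //; lra.
lra.
Qed.

(** * The split graph and graph equality *)

Lemma S_rel_simple (k m : nat) : simple_graph (@S_rel k m).
Proof.
split=> [[[a|a]|a] [[b|b]|b]|[[a|a]|a]] //=; first by rewrite eq_sym.
by rewrite eqxx.
Qed.

Lemma sum_S_vert (R : realType) (k m : nat) (F : S_vert k m -> R) :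
  \sum_v F v = \sum_i F (inl (inl i)) + \sum_j F (inl (inr j)) + F (inr tt).
Proof.
rewrite big_sumType /= big_sumType /=; congr (_ + _).
by rewrite (big_pred1 tt) // => [[]].
Qed.

Definition S_test (R : realType) (k m : nat) (a : 'I_k -> R) (b c : R)
  (v : S_vert k m) : R :=
  match v with inl (inl i) => a i | inl (inr _) => b | inr _ => c end.

Lemma sqr_S_test (R : realType) (k m : nat) (a : 'I_k -> R) (b c : R) :
  \sum_v (@S_test R k m a b c v) ^+ 2 =
  \sum_i a i ^+ 2 + (S_t' k m)%:R * b ^+ 2 + c ^+ 2.
Proof. by rewrite sum_S_vert /= sumr_const card_ord mulr_natl. Qed.

Lemma quad_S_test (R : realType) (k m : nat) (a : 'I_k -> R) (b c : R) :
  quad (@S_rel k m) (@S_test R k m a b c) =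
  (\sum_i a i) ^+ 2 - \sum_i a i ^+ 2 +
  2 * ((S_t' k m)%:R * b * \sum_i a i) + 2 * (c * \sum_(i < k | (i < S_r k m)%N) a i).
Proof.
rewrite /quad; under eq_bigr do rewrite big_mkcond /= sum_S_vert /=.
rewrite sum_S_vert /= ?big1_eq ?addr0 ?add0r.
have clq (i : 'I_k) : \sum_(j < k) (if i != j then a i * a j else 0) =
    a i * (\sum_j a j) - a i ^+ 2.
  rewrite -big_mkcond /= mulr_sumr [in RHS](bigD1 i) //= expr2 addrAC subrr add0r.
  by apply: eq_bigl => j; rewrite eq_sym.
have h1 : \sum_(i < k) \sum_(j < S_t' k m) a i * b = (S_t' k m)%:R * b * \sum_i a i.
  by rewrite mulr_sumr; apply: eq_bigr => i _;
    rewrite sumr_const card_ord -mulr_natl; ring.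
have h2 : \sum_(j < S_t' k m) \sum_(i < k) b * a i = (S_t' k m)%:R * b * \sum_i a i.
  by rewrite sumr_const card_ord -mulr_sumr -mulr_natl; ring.
have h3 : \sum_(i < k) (if (i < S_r k m)%N then a i * c else 0) =
    c * \sum_(i < k | (i < S_r k m)%N) a i.
  by rewrite -big_mkcond -mulr_suml mulrC.
have h4 : \sum_(i < k) (if (i < S_r k m)%N then c * a i else 0) =
    c * \sum_(i < k | (i < S_r k m)%N) a i.
  by rewrite -big_mkcond -mulr_sumr.
under eq_bigr do rewrite clq.
by rewrite !big_split /= sumrN -mulr_suml -expr2 h1 h2 h3 h4; ring.
Qed.

(** Ignoring the extra vertex leaves a clique joined to an independent set, whose spectral radius
    [u] is the larger root of u^2 = (k - 1)u + k [T]. Its eigenvector, 1 on the clique and k/[u] on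
    the independent set, is the test vector. *)
Lemma spec_S_ge (R : realType) (k m : nat) : (2 <= k)%N ->
  (k * S_t' k m)%:R <= spec_rad R (@S_rel k m) ^+ 2 - (k%:R - 1) * spec_rad R (@S_rel k m)
  /\ k%:R - 1 <= spec_rad R (@S_rel k m).
Proof.
move=> k2; set l := spec_rad R _; pose T := (S_t' k m)%:R : R.
have kR : 2 <= k%:R :> R by rewrite ler_nat.
have T0 : 0 <= T by rewrite ler0n.
pose s := Num.sqrt ((k%:R - 1) ^+ 2 + 4 * k%:R * T) : R.
pose u := ((k%:R - 1) + s) / 2 : R.
have D0 : 0 <= (k%:R - 1) ^+ 2 + 4 * k%:R * T.
  by rewrite addr_ge0 ?sqr_ge0 // mulr_ge0 // mulr_ge0.
have s2 : s ^+ 2 = (k%:R - 1) ^+ 2 + 4 * k%:R * T by rewrite sqr_sqrtr.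
have s_ge : k%:R - 1 <= s.
  have k1 : 0 <= k%:R - 1 :> R by lra.
  rewrite -(@ler_pXn2r _ 2) // ?nnegrE ?sqrtr_ge0 // s2 lerDl.
  by rewrite mulr_ge0 // mulr_ge0.
have uE : u ^+ 2 = (k%:R - 1) * u + k%:R * T.
  rewrite /u; have -> : ((k%:R - 1 + s) / 2) ^+ 2 =
    (s ^+ 2 + 2 * (k%:R - 1) * s + (k%:R - 1) ^+ 2) / 4 by field.
  by rewrite s2; field.
have u_ge : k%:R - 1 <= u by rewrite /u; lra.
have u0 : 0 < u by lra.
have [ray _] := perron_rayleigh R (inr tt) (proj1 (S_rel_simple k m)).
have := ray (@S_test R k m (fun=> 1) (k%:R / u) 0).
rewrite quad_S_test sqr_S_test -/l.
have -> : \sum_(i < k) (1 : R) ^+ 2 = k%:R.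
  by rewrite (eq_bigr (fun=> 1)) ?sumr_const ?card_ord // => i _; rewrite expr1n.
rewrite sumr_const card_ord expr0n addr0 mul0r mulr0 addr0 -/T.
set Nm := _ + T * _ => le1.
have Nm0 : 0 < Nm.
  have : 0 <= T * (k%:R / u) ^+ 2 by rewrite mulr_ge0 ?sqr_ge0.
  by rewrite /Nm /=; lra.
have ul : u <= l.
  rewrite -(ler_pM2r Nm0); apply: le_trans le1; rewrite le_eqVlt; apply/orP; left.
  apply/eqP; rewrite /Nm; apply: (mulIf (lt0r_neq0 u0)).
  have -> : u * (k%:R + T * (k%:R / u) ^+ 2) * u = u ^+ 2 * k%:R + T * k%:R ^+ 2.
    by field; rewrite gt_eqF.
  rewrite uE; field; exact: lt0r_neq0.
split; last by lra.
have : 0 <= (l - u) * (l + u - (k%:R - 1)) by rewrite mulr_ge0 //; lra.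
rewrite natrM -/T; lra.
Qed.

Lemma same_graph_sym (V W : finType) (e : rel V) (e' : rel W) (v0 : V) :
  same_graph e e' -> same_graph e' e.
Proof.
move=> [phi [phi_inj [phi_im phi_hom]]].
(* [v0] is a dummy value, taken only at isolated vertices of [e']. *)
pose psi w := odflt v0 [pick v in nonisol e | phi v == w].
have psiK w : w \in nonisol e' -> psi w \in nonisol e /\ phi (psi w) = w.
  rewrite -phi_im => /imsetP[v vN ->]; rewrite /psi; case: pickP => [u /andP[uN /eqP ->]//|].
  by move/(_ v); rewrite vN eqxx.
exists psi; split; last split.
- move=> a b aN bN ab; have [_ <-] := psiK a aN; have [_ <-] := psiK b bN.
  by rewrite ab.
- apply/setP => v; apply/imsetP/idP => [[w wN ->]|vN]; first by case: (psiK w wN).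
  have pN : phi v \in nonisol e' by rewrite -phi_im imset_f.
  exists (phi v) => //; have [h1 h2] := psiK _ pN.
  by apply: phi_inj.
- move=> a b aN bN; have [ha {2}<-] := psiK a aN; have [hb {2}<-] := psiK b bN.
  by rewrite phi_hom.
Qed.

(** The Perron vector of [e'] is pulled back along the isomorphism and extended by 0 to the isolated
    vertices. *)
Lemma same_graph_le (R : realType) (V W : finType) (e : rel V) (e' : rel W)
    (v0 : V) (w0 : W) :
  simple_graph e -> simple_graph e' -> same_graph e e' ->
  spec_rad R e' <= spec_rad R e.
Proof.
move=> [es _] [es' _] [phi [phi_inj [phi_im phi_hom]]].
have [ray _] := perron_rayleigh R v0 es.
have [_ [x' px]] := perron_rayleigh R w0 es'.
pose x v := if v \in nonisol e then x' (phi v) else 0.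
have l0 := spec_rad_ge0 R v0 es.
have reidx (F : W -> R) : \sum_(w in nonisol e') F w = \sum_(v in nonisol e) F (phi v).
  by rewrite -phi_im big_imset.
have quadN (U : finType) (f : rel U) (z : U -> R) : symmetric f -> quad f z =
    \sum_(v in nonisol f) \sum_(w in nonisol f) (f v w)%:R * (z v * z w).
  move=> fs; rewrite /quad (bigID [in nonisol f]) /= addrC big1 ?add0r; last first.
    move=> v; rewrite inE negb_exists => /forallP nv.
    by rewrite big1 // => w vw; move: (nv w); rewrite vw.
  apply: eq_bigr => v vN; rewrite (bigID [in nonisol f]) /= addrC big1 ?add0r.
    rewrite big_mkcond [RHS]big_mkcond /=; apply: eq_bigr => w _.
    by case: (f v w); case: (w \in _); rewrite /= ?mul1r ?mul0r.
  move=> w /andP[vw]; rewrite inE negb_exists => /forallP/(_ v).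
  by rewrite fs vw.
have qE : quad e x = quad e' x'.
  rewrite !quadN // reidx; apply: eq_bigr => v vN; rewrite reidx.
  by apply: eq_bigr => w wN; rewrite /x vN wN phi_hom.
have := ray x; rewrite qE (perron_quad px) => le1; apply: le_trans le1 _.
rewrite ler_piMr //.
have -> : \sum_v x v ^+ 2 = \sum_(v in nonisol e) x' (phi v) ^+ 2.
  rewrite [RHS]big_mkcond /=; apply: eq_bigr => v _; rewrite /x.
  by case: ifP; rewrite ?expr0n.
by rewrite -(reidx (fun w => x' w ^+ 2)); exact: perron_le1 px.
Qed.

Lemma same_graph_spec_rad (R : realType) (V W : finType) (e : rel V) (e' : rel W)
    (v0 : V) (w0 : W) :
  simple_graph e -> simple_graph e' -> same_graph e e' ->
  spec_rad R e = spec_rad R e'.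
Proof.
move=> ge ge' se; apply/eqP; rewrite eq_le.
rewrite (same_graph_le R v0 w0 ge ge' se).
by rewrite (same_graph_le R w0 v0 ge' ge (same_graph_sym v0 se)).
Qed.

(** * The extremal structure *)

(* In units of the squared maximal entry, [gain k H j] bounds the square of the
   weight an outer vertex receives from j clique vertices, H being the exact value
   for all k of them; [profile k H N] is the total for N edges packed greedily. *)
Definition gain (R : realType) (k : nat) (H : R) (j : nat) : R :=
  if j == k then H else j%:R ^+ 2.

Definition profile (R : realType) (k : nat) (H : R) (N : nat) : R :=
  (N %/ k)%:R * H + (N %% k)%:R ^+ 2.

(** Convexity of the square: adding [j] to the open block of size [i] either merges the two, with
    surplus 2[i * j], or completes a block. The bracketed condition, both parts proper and nonempty,
    is where a full unit is gained. *)
Lemma profile_step (R : realType) (k : nat) (H : R) (N j : nat) :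
  (1 < k)%N -> k%:R ^+ 2 - 1 <= H -> (j <= k)%N ->
  profile k H N + gain k H j +
    ((0 < N %% k) && (0 < j < k))%N%:R <= profile k H (N + j).
Proof.
move=> k1 Hk jk; have k0 : (0 < k)%N by apply: ltnW.
rewrite /profile /gain; set q := (N %/ k)%N; set i := (N %% k)%N.
have NE : N = (q * k + i)%N := divn_eq N k.
have ik : (i < k)%N by rewrite ltn_mod.
have [jE|jnk] := eqVneq j k.
  rewrite jE ltnn !andbF addr0 divnDr // divnn k0 addn1 modnDr -/q -/i -natr1.
  lra.
have {}jk : (j < k)%N by rewrite ltn_neqAle jnk.
have [ijk|kij] := ltnP (i + j) k.
  have -> : ((N + j) %/ k)%N = q by rewrite NE -addnA divnMDl // divn_small // addn0.
  have -> : ((N + j) %% k)%N = (i + j)%N by rewrite NE -addnA modnMDl modn_small.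
  rewrite natrD jk andbT.
  have [->|i0] := posnP i; first by rewrite /=; lra.
  have [->|j0] := posnP j; first by rewrite /=; lra.
  have : (1 : R) <= i%:R * j%:R by rewrite -natrM ler1n muln_gt0 i0.
  rewrite /=; lra.
have NjE : (N + j)%N = (q.+1 * k + (i + j - k))%N by rewrite NE; lia.
have small : (i + j - k < k)%N by lia.
have -> : ((N + j) %/ k)%N = q.+1.
  by rewrite NjE divnMDl // divn_small // addn0.
have -> : ((N + j) %% k)%N = (i + j - k)%N by rewrite NjE modnMDl modn_small.
rewrite natrB // natrD -natr1.
(* k^2 + (i + j - k)^2 exceeds i^2 + j^2 by 2(k - i)(k - j), at least 2; replacing k^2 by [H] loses
   at most 1. *)
have : (1 : R) <= (k%:R - i%:R) * (k%:R - j%:R).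
  by rewrite -!natrB ?(ltnW ik) ?(ltnW jk) // -natrM ler1n muln_gt0 !subn_gt0 ik.
have : ((0 < i) && (0 < j < k))%N%:R <= 1 :> R by case: (_ && _).
lra.
Qed.

Lemma profile_step_le (R : realType) (k : nat) (H : R) (N j : nat) :
  (1 < k)%N -> k%:R ^+ 2 - 1 <= H -> (j <= k)%N ->
  profile k H N + gain k H j <= profile k H (N + j).
Proof.
move=> k1 Hk jk; have := profile_step N k1 Hk jk.
by case: (_ && _) => /=; lra.
Qed.

Lemma profile_sum (R : realType) (k : nat) (H : R) (I : eqType) (s : seq I) (P : pred I)
    (j : I -> nat) (N : nat) :
  (1 < k)%N -> k%:R ^+ 2 - 1 <= H -> (forall i, P i -> (j i <= k)%N) ->
  profile k H N + \sum_(i <- s | P i) gain k H (j i) <=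
  profile k H (N + \sum_(i <- s | P i) j i).
Proof.
move=> k1 Hk jk; elim: s N => [|i s IHs] N.
  by rewrite !big_nil addn0 addr0.
rewrite !big_cons; case: ifP => // Pi; rewrite addrA addnA.
by apply: le_trans (IHs _); rewrite lerD2r profile_step_le // jk.
Qed.

(** Each unit is packed as an outer vertex with one neighbour, whose gain is 1 because k > 1. *)
Lemma profile_add (R : realType) (k : nat) (H : R) (N f : nat) :
  (1 < k)%N -> k%:R ^+ 2 - 1 <= H -> profile k H N + f%:R <= profile k H (N + f).
Proof.
move=> k1 Hk; elim: f => [|f IHf]; first by rewrite addn0 addr0.
rewrite addnS -natr1 -[(N + f).+1]addn1.
have := profile_step_le (N + f) k1 Hk (ltnW k1).
by rewrite /gain ltn_eqF //; lra.
Qed.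

(** * Recognition of the split graph *)

Section IsSplitGraph.
Variables (k m : nat) (V : finType) (e : rel V) (A : {set V}).
Let j v := #|[set p in A | e v p]|.
Hypotheses (ge : simple_graph e) (k2 : (2 <= k)%N) (cA : #|A| = k).
Hypothesis (clq : forall p q, p \in A -> q \in A -> p != q -> e p q).
Hypothesis (indep : forall v w, v \notin A -> w \notin A -> ~~ e v w).
Hypothesis (uniq_partial : forall v w, v \notin A -> w \notin A ->
  (0 < j v < k)%N -> (0 < j w < k)%N -> v = w).
Hypothesis (sum_j : (\sum_(v | v \notin A) j v = k * S_t' k m + S_r k m)%N).

Let Full := [set v | (v \notin A) && (j v == k)].

Let j_le v : (j v <= k)%N.
Proof. by rewrite -cA; apply: subset_leq_card; apply/subsetP => p /[!inE] /andP[]. Qed.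

Let sum_split : (\sum_(v | v \notin A) j v =
  k * #|Full| + \sum_(v | (v \notin A) && (v \notin Full)) j v)%N.
Proof.
rewrite (bigID [in Full]) /=; congr (_ + _)%N.
rewrite mulnC -sum_nat_const; apply: eq_big => [v|v /andP[_]].
  by rewrite !inE; case: (v \notin A).
by rewrite inE => /andP[_ /eqP].
Qed.

(** Uniqueness of Euclidean division by k: a partial vertex [z] adds fewer than k edges to those of
    the full vertices. *)
Lemma leftover_vertex : exists z, [/\ #|Full| = S_t' k m,
  (0 < S_r k m)%N -> [/\ z \notin A, z \notin Full & j z = S_r k m] &
  forall v, v \notin A -> v \notin Full -> (0 < j v)%N -> v = z /\ (0 < S_r k m)%N].
Proof.
have k0 : (0 < k)%N by apply: ltnW.
have rk : (S_r k m < k)%N by rewrite ltn_mod.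
have partialE v : v \notin A -> v \notin Full -> (0 < j v)%N -> (0 < j v < k)%N.
  move=> vA; rewrite inE vA /= => jk ->; by rewrite ltn_neqAle jk j_le.
have divE a b c d : (b < k -> d < k -> k * a + b = k * c + d -> a = c /\ b = d)%N.
  move=> bk dk E; have := congr1 (fun n => n %/ k)%N E.
  have := congr1 (fun n => n %% k)%N E.
  rewrite /= ![(k * _)%N]mulnC !modnMDl !modn_small // !divnMDl // !divn_small // !addn0.
  by [].
have [/existsP[z /and3P[zA zF jz]]|] :=
  boolP [exists z, [&& z \notin A, z \notin Full & (0 < j z)%N]].
  have zp := partialE z zA zF jz.
  have E : (k * #|Full| + j z = k * S_t' k m + S_r k m)%N.
    rewrite -sum_j sum_split (bigD1 z) /= ?zA //; congr (_ + _)%N.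
    rewrite big1 ?addn0 // => v /andP[/andP[vA vF] vz]; apply/eqP.
    rewrite -leqn0 leqNgt; apply: contra vz => jv.
    by apply/eqP; apply: uniq_partial => //; apply: partialE.
  have [FE jE] := divE _ _ _ _ (proj2 (andP zp)) rk E.
  exists z; split => // v vA vF jv.
  split; first by apply: uniq_partial => //; exact: partialE.
  by rewrite -jE.
rewrite negb_exists => /forallP none.
have none' v : v \notin A -> v \notin Full -> j v = 0%N.
  by move=> vA vF; have := none v; rewrite vA vF /= -leqNgt leqn0 => /eqP.
have E : (k * #|Full| + 0 = k * S_t' k m + S_r k m)%N.
  by rewrite -sum_j sum_split big1 // => v /andP[]; exact: none'.
have [FE rE] := divE _ _ _ _ k0 rk E.
(* No partial vertex: the remainder is 0 and any vertex can stand for [z]. *)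
have /card_gt0P[v0 _] : (0 < #|A|)%N by rewrite cA.
exists v0; split => //; first by rewrite -rE.
by move=> v vA vF; rewrite none'.
Qed.

Lemma same_graph_S : same_graph e (@S_rel k m).
Proof.
have k0 : (0 < k)%N by apply: ltnW.
have [z [cF zP zU]] := leftover_vertex; have [es ei] := ge.
apply: (same_graph_sym (inr tt)).
(* Listing the neighbours of [z] first makes adjacency to [z] the condition that the index be below
   the remainder. *)
pose sA := [seq p <- enum A | e z p] ++ [seq p <- enum A | ~~ e z p].
have pA : perm_eq sA (enum A) by apply/permPl; exact: perm_filterC.
have uA : uniq sA by rewrite (perm_uniq pA) enum_uniq.
have mA p : (p \in sA) = (p \in A) by rewrite (perm_mem pA) mem_enum.
have szA : size sA = k by rewrite (perm_size pA) -cardE cA.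
have szF : size (enum Full) = S_t' k m by rewrite -cardE cF.
pose psi (v : S_vert k m) := match v with
  inl (inl i) => nth z sA i | inl (inr b) => nth z (enum Full) b | inr _ => z end.
have psiA i : psi (inl (inl i)) \in A by rewrite -mA mem_nth // szA.
have psiF b : psi (inl (inr b)) \in Full by rewrite -mem_enum mem_nth // szF.
have FA v : v \in Full -> v \notin A by rewrite inE => /andP[].
have eFA v p : v \in Full -> p \in A -> e v p.
  rewrite inE => /andP[_ /eqP jv] pA'.
  have /setP/(_ p) : [set q in A | e v q] = A.
    by apply/eqP; rewrite eqEcard cA -jv leqnn andbT; apply/subsetP => q /[!inE] /andP[].
  by rewrite inE pA'.
have ez i : (0 < S_r k m)%N -> e z (psi (inl (inl i))) = (i < S_r k m)%N.
  case/zP => _ _ jz; rewrite /psi /sA nth_cat.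
  have szN : size [seq p <- enum A | e z p] = S_r k m.
    rewrite -jz /j cardE /enum_mem -filter_predI; congr size.
    by apply: eq_filter => p; rewrite /= !inE andbC.
  rewrite szN; case: ifP => ir.
    have : nth z [seq p <- enum A | e z p] i \in [seq p <- enum A | e z p].
      by apply: mem_nth; rewrite szN.
    by rewrite mem_filter => /andP[].
  have : nth z [seq p <- enum A | ~~ e z p] (i - S_r k m) \in [seq p <- enum A | ~~ e z p].
    apply: mem_nth; rewrite ltn_subLR; last by rewrite leqNgt ir.
    by rewrite -szN -size_cat -/sA szA.
  by rewrite mem_filter => /andP[/negbTE].
have rN (c : unit) : (inr c : S_vert k m) \in nonisol (@S_rel k m) -> (0 < S_r k m)%N.
  by rewrite inE => /existsP[[[i|b]|?]] //=; apply: leq_trans.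
have hom : {in nonisol (@S_rel k m) &, forall u v, e (psi u) (psi v) = S_rel u v}.
  move=> [[i|b]|c] [[i'|b']|c'] uN vN.
  - rewrite /= -(inj_eq val_inj) -(nth_uniq z _ _ uA) ?szA ?ltn_ord //.
    have [->|ne] := eqVneq (nth z sA i) (nth z sA i'); first by rewrite ei.
    exact: clq (psiA i) (psiA i') ne.
  - by rewrite es eFA.
  - by rewrite es /= ez // (rN _ vN).
  - by rewrite eFA.
  - by apply/negbTE/indep; apply: FA.
  - by case: (zP (rN _ vN)) => zA _ _; apply/negbTE/indep => //; apply: FA.
  - by rewrite ez // (rN _ uN).
  - by case: (zP (rN _ uN)) => zA _ _; apply/negbTE/indep => //; apply: FA.
  - by rewrite /= ei.
exists psi; split; last split => //.
  move=> [[i|b]|c] [[i'|b']|c'] uN vN.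
  - by move/eqP; rewrite /= nth_uniq ?szA // => /eqP/val_inj ->.
  - by move=> E; have := FA _ (psiF b'); rewrite -E psiA.
  - by move=> E; case: (zP (rN _ vN)) => zA _ _; move: zA; rewrite -[z]E psiA.
  - by move=> E; have := FA _ (psiF b); rewrite E psiA.
  - by move/eqP; rewrite /= nth_uniq ?szF ?enum_uniq // => /eqP/val_inj ->.
  - by move=> E; case: (zP (rN _ vN)) => _ zF _; move: zF; rewrite -[z]E psiF.
  - by move=> E; case: (zP (rN _ uN)) => zA _ _; move: zA; rewrite [z]E psiA.
  - by move=> E; case: (zP (rN _ uN)) => _ zF _; move: zF; rewrite [z]E psiF.
  - by case: c uN; case: c' vN.
apply/setP => v; apply/imsetP/idP.
  case=> u uN ->; move: (uN); rewrite inE => /existsP[w uw].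
  have [es' _] := S_rel_simple k m.
  have wN : w \in nonisol (@S_rel k m).
    by rewrite inE; apply/existsP; exists u; rewrite es'.
  by rewrite inE; apply/existsP; exists (psi w); rewrite hom.
rewrite inE => /existsP[w vw].
have [vA|vA] := boolP (v \in A).
  have iv : (index v sA < k)%N by rewrite -szA index_mem mA.
  exists (inl (inl (Ordinal iv))); last by rewrite /= nth_index ?mA.
  (* A clique index other than that of [v]: 1 if that index is 0, and 0 otherwise. *)
  have i2 : ((index v sA == 0) < k)%N by case: (_ == _).
  rewrite inE; apply/existsP; exists (inl (inl (Ordinal i2))).
  by rewrite /= -(inj_eq val_inj) /=; case: (index v sA).
have [vF|vF] := boolP (v \in Full).
  have iv : (index v (enum Full) < S_t' k m)%N by rewrite -szF index_mem mem_enum.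
  exists (inl (inr (Ordinal iv))); last by rewrite /= nth_index ?mem_enum.
  by rewrite inE; apply/existsP; exists (inl (inl (Ordinal k0))).
have wA : w \in A by apply: contraLR vw => wA; exact: indep.
have [|-> r0] := zU v vA vF.
  by apply/card_gt0P; exists w; rewrite inE wA.
exists (inr tt) => //; rewrite inE; apply/existsP.
by exists (inl (inl (Ordinal k0))).
Qed.

End IsSplitGraph.

(** * Comparison with the split graph *)

Lemma profile0 (R : realType) (k : nat) (H : R) : profile k H 0 = 0.
Proof. by rewrite /profile div0n mod0n mul0r expr0n addr0. Qed.

(** Pack [v] and [w] first: [w] then meets an open block of size [j v], and [profile_step] yields
    the surplus 1. *)
Lemma profile_sum_two (R : realType) (k : nat) (H : R) (V : finType) (P : pred V)
    (j : V -> nat) (v w : V) :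
  (1 < k)%N -> k%:R ^+ 2 - 1 <= H -> (forall i, P i -> (j i <= k)%N) ->
  P v -> P w -> v != w -> (0 < j v < k)%N -> (0 < j w < k)%N ->
  \sum_(i | P i) gain k H (j i) + 1 <= profile k H (\sum_(i | P i) j i).
Proof.
move=> k1 Hk jk Pv Pw vw jv jw.
have Pw' : P w && (w != v) by rewrite Pw eq_sym.
rewrite (bigD1 v) // (bigD1 w) //= [in leRHS](bigD1 v) // [in leRHS](bigD1 w) //=.
have h1 := profile_step_le 0 k1 Hk (jk v Pv); rewrite profile0 add0r add0n in h1.
have h2 := profile_step (j v) k1 Hk (jk w Pw).
have h3 := @profile_sum R k H V (index_enum V) (fun i => (P i && (i != v)) && (i != w)) j
  (j v + j w) k1 Hk (fun i Pi => jk i (proj1 (andP (proj1 (andP Pi))))).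
rewrite addnA; apply: le_trans h3.
case/andP: (jv) => jv0 jvk.
by move: h1 h2; rewrite modn_small // jv0 jw /=; lra.
Qed.

(* Transplanting the Perron vector of [e] to the split graph, with the two kinds
   of outer vertices revalued by the eigenvalue equation. *)
Lemma transplant_le (R : realType) (k m : nat) (V : finType) (e : rel V) (l : R)
    (x : V -> R) (A : {set V}) (X d : R) :
  simple_graph e -> perron e l x -> 0 < X ->
  (forall v, v \in A -> (1 - d) * X <= x v) -> d <= 1 ->
  #|A| = k -> (0 < k)%N -> (forall p q, p \in A -> q \in A -> p != q -> e p q) ->
  0 < l -> spec_rad R (@S_rel k m) <= l ->
  (S_t' k m)%:R * (\sum_(p in A) x p) ^+ 2 + ((S_r k m)%:R * ((1 - d) * X)) ^+ 2 <=
  \sum_(v | v \notin A) (\sum_(p | (p \in A) && e v p) x p) ^+ 2 +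
  \sum_(v | v \notin A) (\sum_(w | (w \notin A) && e v w) x w) *
                        (\sum_(p | (p \in A) && e v p) x p).
Proof.
move=> ge px X0 xA d1 cA k0 clq l0 Sl.
have [es ei] := ge.
have /card_gt0P[v0 v0A] : (0 < #|A|)%N by rewrite cA.
pose al (i : 'I_k) := nth v0 (enum A) i.
have szA : size (enum A) = k by rewrite -cardE.
have alA i : al i \in A by rewrite -mem_enum mem_nth ?szA.
have alE (F : V -> R) : \sum_i F (al i) = \sum_(p in A) F p.
  by rewrite -[RHS]big_enum /= (big_nth v0) big_mkord szA.
set sg := \sum_(p in A) x p; set r := S_r k m; set T := (S_t' k m)%:R : R.
pose rho := \sum_(i < k | (i < r)%N) x (al i).
have rho_ge : r%:R * ((1 - d) * X) <= rho.
  apply: (@le_trans _ _ (\sum_(i < k | (i < r)%N) (1 - d) * X)).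
    rewrite -(big_ord_widen k (fun=> (1 - d) * X)).
      by rewrite sumr_const card_ord mulr_natl.
    by rewrite ltnW // ltn_mod.
  by apply: ler_sum => i _; apply: xA.
have [ray _] := perron_rayleigh R (inr tt) (proj1 (S_rel_simple k m)).
have := ray (@S_test R k m (fun i => x (al i)) (sg / l) (rho / l)).
rewrite quad_S_test sqr_S_test (alE x) (alE (fun p => x p ^+ 2)) -/sg -/rho -/T.
set yA := \sum_(p in A) x p ^+ 2; set Nm := yA + _ + _ => le1.
have Nm0 : 0 <= Nm.
  have yA0 : 0 <= yA by apply: sumr_ge0 => *; exact: sqr_ge0.
  apply: addr_ge0; last exact: sqr_ge0.
  by apply: addr_ge0 => //; apply: mulr_ge0; rewrite ?ler0n ?sqr_ge0.
have le2 := le_trans le1 (ler_wpM2r Nm0 Sl).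
have spl := perron_split A es px.
have QE : \sum_(p in A) \sum_(q | (q \in A) && e p q) x p * x q = sg ^+ 2 - yA.
  rewrite -clique_sum; apply: eq_bigr => p pA; apply: eq_bigl => q.
  case qA: (q \in A) => //=; have [->|qp] := eqVneq q p; first by rewrite ei.
  by rewrite clq // eq_sym.
rewrite QE -/yA in spl.
(* The outer terms occur twice in the form and once in the squared norm, so one copy survives. *)
have le3 : l * (sg ^+ 2 - yA) + T * sg ^+ 2 + rho ^+ 2 <= l ^+ 2 * yA.
  have := ler_wpM2l (ltW l0) le2.
  have -> : l * (sg ^+ 2 - yA + 2 * (T * (sg / l) * sg) + 2 * (rho / l * rho)) =
     l * (sg ^+ 2 - yA) + 2 * T * sg ^+ 2 + 2 * rho ^+ 2 by field; exact: lt0r_neq0.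
  have -> : l * (l * Nm) = l ^+ 2 * yA + T * sg ^+ 2 + rho ^+ 2.
    by rewrite /Nm; field; exact: lt0r_neq0.
  lra.
have rho2 : (r%:R * ((1 - d) * X)) ^+ 2 <= rho ^+ 2.
  have h0 : 0 <= r%:R * ((1 - d) * X).
    by rewrite !mulr_ge0 ?(ltW X0) // subr_ge0.
  by rewrite ler_pXn2r ?nnegrE // (le_trans h0).
rewrite spl in le3; lra.
Qed.

(** Let [f] be the number of edges outside [A]. In units of [X]^2, transplanting gives
    [T * H + r ^ 2 <= G + f / 8 + 1 / 8], while greedy packing exceeds [G] by at least [f], and by
    at least 1 if two outer vertices are partial. So [f] is 0 and at most one vertex is partial. *)
Lemma extremal_is_split (R : realType) (k m : nat) (V : finType) (e : rel V) (l : R)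
    (x : V -> R) (A : {set V}) (X d : R) :
  simple_graph e -> perron e l x -> 0 < X -> (forall v, x v <= X) ->
  (forall v, v \in A -> (1 - d) * X <= x v) ->
  (forall v, v \notin A -> x v <= d * X) -> 0 <= d -> d * (16 * k%:R ^+ 2) <= 1 ->
  (2 <= k)%N -> #|A| = k -> (forall p q, p \in A -> q \in A -> p != q -> e p q) ->
  vol R e = 2 * m%:R -> ('C(k, 2) <= m)%N -> 0 < l -> spec_rad R (@S_rel k m) <= l ->
  same_graph e (@S_rel k m).
Proof.
move=> ge px X0 xX xA xT d0 dk k2 cA clq volE km l0 Sl.
have [es ei] := ge; have x0 v : 0 <= x v by case: px.
have kR : 2 <= k%:R :> R by rewrite ler_nat.
have dk2 : d * k%:R ^+ 2 <= 1 / 16 by lra.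
have dk1 : d * k%:R <= 1 / 16.
  apply: le_trans dk2; apply: ler_wpM2l => //.
  by rewrite expr2 -[leLHS]mulr1 ler_pM2l; lra.
have d1 : d <= 1 / 16.
  by apply: le_trans dk1; rewrite -[leLHS]mulr1; apply: ler_wpM2l => //; lra.
pose j v := #|[set p in A | e v p]|.
have jE v : \sum_(p | (p \in A) && e v p) 1 = (j v)%:R :> R.
  by rewrite sum1r_card; congr (_%:R); apply: eq_card => p; rewrite inE.
have jk v : (j v <= k)%N.
  by rewrite -cA; apply: subset_leq_card; apply/subsetP => p /[!inE] /andP[].
pose J := (\sum_(v | v \notin A) j v)%N.
pose F := (\sum_(v | v \notin A) #|[set w | (w \notin A) && e v w]|)%N.
have FE : \sum_(v | v \notin A) \sum_(w | (w \notin A) && e v w) 1 = F%:R :> R.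
  rewrite natr_sum; apply: eq_bigr => v _; rewrite sum1r_card; congr (_%:R).
  by apply: eq_card => w; rewrite inE.
have WE : \sum_(p in A) \sum_(q | (q \in A) && e p q) 1 = (k * k.-1)%:R :> R.
  rewrite -{1}cA -sum_nat_const natr_sum; apply: eq_bigr => p pA.
  rewrite sum1r_card; congr (_%:R); rewrite -cA (cardsD1 p A) pA /=.
  apply: eq_card => q; rewrite !inE [RHS]andbC unfold_in.
  case qA: (q \in A) => //=; have [->|qp] := eqVneq q p; first by rewrite ei.
  by rewrite clq // eq_sym.
set T := S_t' k m; set r := S_r k m.
have count : (J * 2 + F = (k * T + r) * 2)%N.
  have bin : ('C(k, 2) * 2 = k * k.-1)%N by rewrite mulnC -mul_bin_diag bin1.
  have dv : (m - 'C(k, 2) = k * T + r)%N.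
    by rewrite mulnC; exact: divn_eq.
  have vE : (k * k.-1 + 2 * J + F = 2 * m)%N.
    apply/eqP; rewrite -(eqr_nat R) (natrD _ (k * k.-1 + 2 * J)) (natrD _ (k * k.-1)).
    rewrite (natrM _ 2 J) (natrM _ 2 m); apply/eqP.
    rewrite -volE (vol_split R A ge) WE FE; congr (_ + _ * _ + _).
    by rewrite natr_sum; apply: eq_bigr => v _; rewrite jE.
  by move: vE bin dv km; clear; lia.
(* [F] counts ordered pairs, so it is even. *)
have [f [FfE JfE]] : exists f, F = (2 * f)%N /\ (J + f = k * T + r)%N.
  exists (k * T + r - J)%N.
  have JkT : (J <= k * T + r)%N by move: count; clear; lia.
  by split; [move: count JkT; clear; lia | rewrite subnKC].
have key := @transplant_le R k m V e l x A X d ge px X0 xA.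
have {}key := key _ cA (ltnW k2) clq l0 Sl; rewrite -/T -/r in key.
set sg := \sum_(p in A) x p in key.
pose H := sg ^+ 2 / X ^+ 2.
have X2 : 0 < X ^+ 2 by rewrite exprn_gt0.
have HE : sg ^+ 2 = X ^+ 2 * H by rewrite /H mulrC divfK // gt_eqF.
have Hk : k%:R ^+ 2 - 1 <= H.
  rewrite /H ler_pdivlMr //.
  have sg_ge : k%:R * ((1 - d) * X) <= sg.
    rewrite -cA -(@sum1r_card R _ [in A]) mulr_suml.
    by apply: ler_sum => p pA; rewrite mul1r xA.
  have kd : 0 <= k%:R * ((1 - d) * X).
    by rewrite !mulr_ge0 ?(ltW X0) //; lra.
  have : (k%:R * ((1 - d) * X)) ^+ 2 <= sg ^+ 2.
    by rewrite ler_pXn2r ?nnegrE // (le_trans kd).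
  apply: le_trans; rewrite !exprMn mulrA ler_pM2r //.
  by have := mulr_ge0 (sqr_ge0 d) (sqr_ge0 (k%:R : R)); lra.
have lgain v : (\sum_(p | (p \in A) && e v p) x p) ^+ 2 <= X ^+ 2 * gain k H (j v).
  have l0' : 0 <= \sum_(p | (p \in A) && e v p) x p by apply: sumr_ge0.
  rewrite /gain; case: ifP => _.
    rewrite -HE ler_pXn2r ?nnegrE ?sumr_ge0 //.
    by apply: ler_psum => // p /andP[].
  rewrite -exprMn ler_pXn2r ?nnegrE ?mulr_ge0 ?(ltW X0) //.
  by rewrite -jE mulr_sumr; apply: ler_sum => p _; rewrite mulr1.
have cross := @cross_term_le R V e l x A X d px X0 xX xT.
rewrite FE cA FfE natrM in cross.
have lsum : \sum_(v | v \notin A) (\sum_(p | (p \in A) && e v p) x p) ^+ 2 <=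
    X ^+ 2 * \sum_(v | v \notin A) gain k H (j v).
  by rewrite mulr_sumr; apply: ler_sum.
set G := \sum_(v | v \notin A) gain k H (j v) in lsum.
have prof : profile k H (k * T + r) = T%:R * H + r%:R ^+ 2.
  have rk : (r < k)%N by rewrite ltn_mod ltnW.
  by rewrite /profile mulnC divnMDl ?(ltnW k2) // divn_small // addn0 modnMDl modn_small.
have addf := profile_add J f k2 Hk; rewrite JfE prof in addf.
(* One error 1/8 bounds 2[d * r ^ 2], lost on the extra vertex; the other bounds 2[d * k] per edge
   outside [A]. *)
have key2 : T%:R * H + r%:R ^+ 2 - 1 / 8 <= G + f%:R / 8.
  rewrite -(ler_pM2l X2).
  have c2 : 2 * f%:R * (d * X) * (k%:R * X) <= X ^+ 2 * (f%:R / 8).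
    have -> : 2 * f%:R * (d * X) * (k%:R * X) = X ^+ 2 * (2 * f%:R * (d * k%:R)) by ring.
    rewrite ler_pM2l //; have f0 : 0 <= f%:R :> R by rewrite ler0n.
    by have := ler_wpM2l f0 dk1; lra.
  have r2 : X ^+ 2 * (r%:R ^+ 2 - 1 / 8) <= (r%:R * ((1 - d) * X)) ^+ 2.
    have -> : (r%:R * ((1 - d) * X)) ^+ 2 = X ^+ 2 * (r%:R ^+ 2 * (1 - d) ^+ 2) by ring.
    rewrite ler_pM2l //.
    have : d * r%:R ^+ 2 <= 1 / 16.
      apply: le_trans dk2; apply: ler_wpM2l => //.
      by rewrite ler_pXn2r ?nnegrE // ler_nat ltnW // ltn_mod ltnW.
    by have := mulr_ge0 (sqr_ge0 d) (sqr_ge0 (r%:R : R)); lra.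
  have d1' : d <= 1 by lra.
  have := key d1'; rewrite HE; move: cross lsum c2 r2.
  set S1 := \sum_(v | _) _ ^+ 2; set S2 := \sum_(v | _) _ * _.
  lra.
have f0 : f = 0%N.
  apply/eqP; rewrite -leqn0 leqNgt; apply/negP => f1.
  have f1R : 1 <= f%:R :> R by rewrite ler1n.
  have := @profile_sum R k H V (index_enum V) (fun v => v \notin A) j 0 k2 Hk
    (fun v _ => jk v).
  rewrite profile0 add0r add0n -/G -/J; lra.
apply: (@same_graph_S k m V e A) => //.
- move=> v w vA wA; apply/negP => vw.
  have : (0 < F)%N.
    rewrite /F (bigD1 v) //= addn_gt0; apply/orP; left.
    by apply/card_gt0P; exists w; rewrite inE wA vw.
  by rewrite FfE f0.
- move=> v w vA wA jv jw; apply/eqP/negPn/negP => vw.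
  have := @profile_sum_two R k H V (fun v => v \notin A) j v w k2 Hk
    (fun v _ => jk v) vA wA vw jv jw.
  rewrite -/G -/J; move: addf key2; rewrite f0; lra.
- by rewrite -/J -JfE f0 addn0.
Qed.

(** * From the cleaned subgraph back to the whole graph *)

Lemma spec_large (R : realType) (k m : nat) (l : R) : (2 <= k)%N ->
  (4 * k ^ 6 + k ^ 2 < m)%N -> 0 <= l ->
  m%:R - k%:R ^+ 2 <= l ^+ 2 - (k%:R - 1) * l ->
  2 * k%:R ^+ 3 < l /\ m%:R < l ^+ 2.
Proof.
move=> k2; rewrite -(ltr_nat R) natrD natrM !natrX => mk l0 lk.
have kR : 2 <= k%:R :> R by rewrite ler_nat.
have kl0 : 0 <= (k%:R - 1) * l by rewrite mulr_ge0 //; lra.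
have lgt : 2 * k%:R ^+ 3 < l.
  rewrite ltNge; apply/negP => lle.
  have : l ^+ 2 <= (2 * k%:R ^+ 3) ^+ 2.
    by rewrite ler_pXn2r ?nnegrE // (le_trans l0).
  have -> : (2 * k%:R ^+ 3) ^+ 2 = 4 * k%:R ^+ 6 :> R by ring.
  lra.
split=> //.
have k3 : k%:R ^+ 2 <= 2 * k%:R ^+ 3 :> R.
  have -> : 2 * k%:R ^+ 3 = k%:R ^+ 2 * (2 * k%:R) :> R by ring.
  by rewrite -[leLHS]mulr1 ler_pM2l ?exprn_gt0; lra.
have : l <= (k%:R - 1) * l by rewrite -[leLHS]mul1r ler_wpM2r //; lra.
lra.
Qed.

Lemma atom_clique_structure (k t h : nat) : (2 <= k)%N -> (0 < h)%N ->
  exists m1 : nat, forall (m : nat), (m1 <= m)%N ->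
  forall (R : realType) (V : finType) (e : rel V) (l : R) (x : V -> R),
  simple_graph e -> F_free (@Kplus_rel k t) e -> perron e l x ->
  vol R e = 2 * m%:R -> 0 <= l ->
  m%:R - k%:R ^+ 2 <= l ^+ 2 - (k%:R - 1) * l ->
  (exists v, 1 <= x v ^+ 2 * h%:R) ->
  exists (A B : {set V}) (X d : R),
    [/\ [/\ #|A| = k, forall p q, p \in A -> q \in A -> p != q -> e p q &
            l ^+ 2 - (k%:R - 1) * l <= m%:R],
        [/\ 0 < X, 0 <= d & d * (16 * k%:R ^+ 2) <= 1],
        forall v, x v <= X, forall v, v \in A -> (1 - d) * X <= x v &
        [/\ forall v, v \notin A -> x v <= d * X,
          forall a b, a \in A -> b \in B -> e a b &
          (1 - 1 / 64) * m%:R <= k%:R * #|B|%:R :> R]].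
Proof.
move=> k2 h0; pose D := (16 * k ^ 2)%N.
have k4 : (4 <= k ^ 2)%N by rewrite -[4%N]/(2 ^ 2)%N leq_exp2r.
have D64 : (64 <= D)%N by rewrite -[64%N]/(16 * 4)%N leq_mul2l.
have [m1 atoms] := @atom_structure h D h0 (leq_trans (isT : (1 < 64)%N) D64).
(* The three summands serve [atom_structure], [spec_large] and the bound [t < #|B|]. *)
exists (m1 + (4 * k ^ 6 + k ^ 2).+1 + 8 * h * t.+1)%N => m hm R V e l x ge Ff px volE l0 lk xh.
have mm1 : (m1 <= m)%N by apply: leq_trans hm; rewrite -addnA leq_addr.
have mk : (4 * k ^ 6 + k ^ 2 < m)%N.
  by apply: leq_trans hm; rewrite addnAC leq_addl.
have mt : (8 * h * t.+1 <= m)%N by apply: leq_trans hm; rewrite leq_addl.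
have [lgt ml] := spec_large k2 mk l0 lk.
have [A [B [X [[A0 A4h] X0 xX xA [xT eAB AB]]]]] :=
  atoms m mm1 R V e l x ge px volE (ltW ml) xh.
have DR : D%:R = 16 * k%:R ^+ 2 :> R by rewrite /D natrM natrX.
have D64R : 64 <= D%:R :> R by rewrite ler_nat.
have dle : D%:R^-1 <= 1 / 64 :> R by rewrite div1r lef_pV2 ?posrE; lra.
have d0 : 0 < D%:R^-1 :> R by rewrite invr_gt0; lra.
have m0 : 0 < m%:R :> R by rewrite ltr0n; apply: leq_ltn_trans mk.
have AB' : (1 - 1 / 64) * m%:R <= #|A|%:R * #|B|%:R :> R.
  by apply: le_trans AB; rewrite ler_pM2r //; lra.
have tB : (t < #|B|)%N.
  rewrite ltnNge; apply/negP => Bt.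
  have : (#|A| * #|B| <= 4 * h * t)%N by apply: leq_mul.
  rewrite -(ler_nat R) natrM => le1.
  have le2 : (8 * h * t.+1)%:R <= m%:R :> R by rewrite ler_nat.
  have hR : 0 < h%:R :> R by rewrite ltr0n.
  have tR : 0 <= h%:R * t%:R :> R by rewrite mulr_ge0.
  rewrite !natrM -natr1 in le1 le2; lra.
have d18 : D%:R^-1 <= 1 / 8 :> R by lra.
have [cA clq lup] := atom_is_clique ge px X0 xX xA xT d18 k2 Ff A0 tB eAB volE ml lk lgt.
exists A, B, X, (D%:R^-1); split => //.
- split => //; first exact: ltW.
  by rewrite -DR mulVf // gt_eqF //; lra.
- by split => //; rewrite -cA.
Qed.

(** At most [m]/8 edges avoid [A], so the form outside [A] is at most [l]/2. The eigenvalue equation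
    then shows that the outer weight exceeds the weight of [A] by at most 1/2, and both sum to 1. *)
Lemma clique_part_heavy (R : realType) (V : finType) (e : rel V) (l : R) (x : V -> R)
    (A B : {set V}) (m : R) :
  simple_graph e -> perron e l x -> vol R e = 2 * m -> m <= l ^+ 2 -> 0 < l ->
  (forall a b, a \in A -> b \in B -> e a b) ->
  7 / 8 * m <= #|A|%:R * #|B|%:R ->
  1 / 4 <= \sum_(p in A) x p ^+ 2.
Proof.
move=> ge px volE ml l0 eAB AB; have [es ei] := ge.
have [x0 x1 ex] := px.
have volS := vol_split R A ge; rewrite volE in volS.
have J_ge : #|A|%:R * #|B|%:R <= \sum_(v | v \notin A) \sum_(p | (p \in A) && e v p) 1 :> R.
  rewrite mulrC -(@sum1r_card R _ [in B]) mulr_suml.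
  apply: (@le_trans _ _ (\sum_(v in B) \sum_(p | (p \in A) && e v p) 1)).
    apply: ler_sum => b bB; rewrite mul1r -(@sum1r_card R _ [in A]).
    by apply: ler_psum => // p pA; rewrite pA es eAB.
  apply: ler_psum => [b bB|b _]; last exact: sumr_ge0.
  by apply/negP => bA; have := eAB b b bA bB; rewrite ei.
have W0 : 0 <= \sum_(p in A) \sum_(q | (q \in A) && e p q) 1 :> R.
  by apply: sumr_ge0 => *; apply: sumr_ge0.
pose sT := \sum_(v | v \notin A) \sum_(w | (w \notin A) && e v w) x v * x w.
have sT0 : 0 <= sT by apply: sumr_ge0 => *; apply: sumr_ge0 => *; apply: mulr_ge0.
have sT_le : sT <= l / 2.
  rewrite -(@ler_pXn2r _ 2) // ?nnegrE ?divr_ge0 ?(ltW l0) //.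
  apply: le_trans (sum_pairs_sqr_le _ _ _ _) _.
  have y1 : (\sum_(v | v \notin A) x v ^+ 2) * (\sum_(v | v \notin A) x v ^+ 2) <= 1.
    by rewrite mulr_ile1 ?(perron_le1 _ px) // sumr_ge0 // => *; exact: sqr_ge0.
  have F0 : 0 <= \sum_(v | v \notin A) \sum_(w | (w \notin A) && e v w) 1 :> R.
    by apply: sumr_ge0 => *; apply: sumr_ge0.
  apply: le_trans (ler_wpM2l F0 y1) _.
  by rewrite mulr1 exprMn exprVn; lra.
pose c := \sum_(v | v \notin A) \sum_(p | (p \in A) && e v p) x v * x p.
have TE : l * \sum_(v | v \notin A) x v ^+ 2 = c + sT.
  rewrite mulr_sumr -big_split; apply: eq_bigr => v _ /=.
  rewrite expr2 mulrA ex mulr_suml (bigID [in A]) /=; congr (_ + _).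
    by apply: eq_big => [w|w _]; [rewrite andbC|rewrite mulrC].
  by apply: eq_big => [w|w _]; [rewrite andbC|rewrite mulrC].
have c_le : c <= l * \sum_(p in A) x p ^+ 2.
  rewrite /c (exchange_big_dep [in A]) /=; last by move=> ? ? _ /andP[].
  rewrite mulr_sumr; apply: ler_sum => p pA.
  rewrite expr2 mulrA ex mulr_suml.
  apply: ler_psum => [v /and3P[_ _]|v _]; first by rewrite es.
  exact: mulr_ge0.
have yE : \sum_(p in A) x p ^+ 2 + \sum_(v | v \notin A) x v ^+ 2 = 1.
  by rewrite -x1 [RHS](bigID [in A]).
set yA := \sum_(p in A) _ in c_le yE *; set yT := \sum_(v | _) _ in TE yE.
have : l * (yT - yA) <= l * (1 / 2) by lra.
rewrite ler_pM2l //; lra.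
Qed.

Lemma spec_rad_induced_le (R : realType) (V : finType) (e : rel V) (S : {set V})
    (v0 : V) : simple_graph e -> spec_rad R (induced e S) <= spec_rad R e.
Proof.
move=> ge; have [es' _] := induced_simple S ge.
have [_ [x px]] := perron_rayleigh R v0 es'.
have [ray _] := perron_rayleigh R v0 (proj1 ge).
rewrite -[leLHS](perron_quad px); case: (px) => x0 x1 _.
have := ray x; rewrite x1 mulr1; apply: le_trans.
apply: ler_sum => v _; apply: ler_psum => [w /and3P[]//|w _]; exact: mulr_ge0.
Qed.

Lemma vol_induced_le (R : realType) (V : finType) (e : rel V) (S : {set V}) :
  vol R (induced e S) <= vol R e.
Proof. by apply: ler_sum => v _; apply: ler_psum => // w /and3P[]. Qed.

Lemma S_size (k m : nat) : (0 < k)%N -> (k ^ 2 <= m)%N ->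
  (m <= k * S_t' k m + k ^ 2)%N.
Proof.
move=> k0 km; have dv := divn_eq (m - 'C(k, 2)) k.
have rk : ((m - 'C(k, 2)) %% k < k)%N by rewrite ltn_mod.
have bin : (2 * 'C(k, 2) = k * k.-1)%N by rewrite -mul_bin_diag bin1.
rewrite -/(S_t' k m) -/(S_r k m) in dv rk.
have : ('C(k, 2) + k.-1 <= k ^ 2)%N by rewrite expnS expn1; nia.
move: dv rk km bin; rewrite [(S_t' k m * k)%N]mulnC.
set a := (k * S_t' k m)%N; set b := 'C(k, 2); set c := (k ^ 2)%N; set r := S_r k m.
clearbody a b c r; move=> *; lia.
Qed.

(** The atom analysis runs twice: on the cleaned subgraph, to see that few edges were deleted and
    that its clique is heavy in the whole graph too, and then on the whole graph, which thereby has
    an atom. *)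
Lemma extremal_same_graph (k t : nat) : (2 <= k)%N ->
  exists m0 : nat, forall m : nat, (m0 <= m)%N ->
  forall (R : realType) (V : finType) (e : rel V),
  simple_graph e -> #|edges e| = m -> F_free (@Kplus_rel k t) e ->
  spec_rad R (@S_rel k m) <= spec_rad R e -> same_graph e (@S_rel k m).
Proof.
move=> k2; have k0 : (0 < k)%N by apply: ltnW.
(* The first summand serves [clean_has_atom]; 4k makes one of k vertices of total weight at least
   1/4 an atom. *)
pose h := (360 * 2 ^ (12 * k) * t.+1 + 4 * k)%N.
have hh : (360 * 2 ^ (12 * k) * t.+1 <= h)%N by exact: leq_addr.
have h4k : (4 * k <= h)%N by exact: leq_addl.
have h0 : (0 < h)%N by apply: leq_trans h4k; rewrite muln_gt0.
clearbody h.
have [m1 atoms] := @atom_clique_structure k t h k2 h0.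
pose m2 := (m1 + (4 * k ^ 6 + k ^ 2).+1)%N.
exists (31 * m2 + 1000 * k ^ 2)%N => m hm R V e ge em Ff Sl.
have mm1 : (31 * m1 <= m)%N.
  by apply: leq_trans hm; rewrite /m2 mulnDr -addnA leq_addr.
have mk : (31 * (4 * k ^ 6 + k ^ 2).+1 <= m)%N.
  by apply: leq_trans hm; rewrite /m2 mulnDr addnAC leq_addl.
have mk1000 : (1000 * k ^ 2 <= m)%N by apply: leq_trans hm; rewrite leq_addl.
have mk' : (4 * k ^ 6 + k ^ 2 < m)%N by apply: leq_trans mk; rewrite leq_pmull.
clear hm.
have kR : 2 <= k%:R :> R by rewrite ler_nat.
have volE : vol R e = 2 * m%:R by rewrite /vol handshake // em.
have [v0 _] : exists v0 : V, True.
  have /card_gt0P[E] : (0 < #|edges e|)%N by rewrite em; apply: leq_ltn_trans mk'.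
  by rewrite inE => /existsP[v _]; exists v.
have [es ei] := ge.
set l := spec_rad R e in Sl.
have l0 : 0 <= l by exact: spec_rad_ge0 v0 es.
have lk : m%:R - k%:R ^+ 2 <= l ^+ 2 - (k%:R - 1) * l.
  have [S1 S2] := spec_S_ge R m k2.
  set ls := spec_rad R _ in Sl S1 S2.
  have km2 : (k ^ 2 <= m)%N by apply: leq_trans mk1000; rewrite leq_pmull.
  have := S_size k0 km2; rewrite -(ler_nat R) natrD natrX => Sm.
  have : 0 <= (l - ls) * (l + ls - (k%:R - 1)) by rewrite mulr_ge0 //; lra.
  lra.
have [lgt ml] := spec_large k2 mk' l0 lk.
have lpos : 0 < l.
  by apply: le_lt_trans lgt; rewrite mulr_ge0 // exprn_ge0 //; lra.
have [S [PhiS clean]] := exists_clean_subgraph R v0 ge.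
set e' := induced e S in PhiS clean; have ge' : simple_graph e' by exact: induced_simple.
set l' := spec_rad R e' in PhiS clean; pose m' := #|edges e'|.
have volE' : vol R e' = 2 * m'%:R by rewrite /vol handshake.
have l'0 : 0 <= l' by exact: spec_rad_ge0 v0 (proj1 ge').
have l'l : l' <= l by exact: spec_rad_induced_le.
have m'm : m'%:R <= m%:R :> R.
  by have := vol_induced_le R e S; rewrite -/e' volE volE'; lra.
(* The surplus 1/30 = 1 - 29/30 per deleted edge measures how many were deleted. *)
have gap : l ^+ 2 - m%:R + (m%:R - m'%:R) / 30 <= l' ^+ 2 - m'%:R.
  by move: PhiS; rewrite -/l volE volE'; lra.
have lk' : m'%:R - k%:R ^+ 2 + (m%:R - m'%:R) / 30 <= l' ^+ 2 - (k%:R - 1) * l'.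
  have : (k%:R - 1) * l' <= (k%:R - 1) * l by rewrite ler_wpM2l //; lra.
  lra.
have [_ [x' px']] := perron_rayleigh R v0 (proj1 ge').
(* The square of [l'] is at most 2[m'], so [gap] gives ([m] - [m'])/30 <= [m']. *)
have m'31 : (m <= 31 * m')%N.
  rewrite -(ler_nat R) natrM; have := perron_sqr_le_vol px'.
  by rewrite -/(vol R e') volE' -/l'; lra.
have m1m' : (m1 <= m')%N by rewrite -(leq_pmul2l (isT : (0 < 31)%N)) (leq_trans mm1).
have mk'' : (4 * k ^ 6 + k ^ 2 < m')%N.
  by rewrite -(leq_pmul2l (isT : (0 < 31)%N)) (leq_trans mk).
have lk'' : m'%:R - k%:R ^+ 2 <= l' ^+ 2 - (k%:R - 1) * l' by lra.
have [_ ml'] := spec_large k2 mk'' l'0 lk''.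
have Ff' : F_free (@Kplus_rel k t) e' by exact: induced_free.
have vl' : vol R e' < 2 * l' ^+ 2 by rewrite volE'; lra.
have [v1 xv1] := clean_has_atom ge' k2 Ff' hh px' (clean _ px') vl'.
have [A [B [X [d [[cA _ lup] _ _ _ [_ eAB AB]]]]]] :=
  atoms m' m1m' R V e' l' x' ge' Ff' px' volE' l'0 lk'' (ex_intro _ v1 (ltW xv1)).
(* The upper bound [lup] from the clique structure meets the lower bound [lk']. *)
have close : m%:R - m'%:R <= 30 * k%:R ^+ 2 :> R by lra.
have [_ [x px]] := perron_rayleigh R v0 es.
have AB8 : 7 / 8 * m%:R <= #|A|%:R * #|B|%:R :> R.
  rewrite cA; apply: le_trans AB.
  have : (1000 * k ^ 2)%:R <= m%:R :> R by rewrite ler_nat.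
  by rewrite natrM natrX; lra.
have eAB' a b : a \in A -> b \in B -> e a b.
  by move=> aA bB; have /and3P[] := eAB a b aA bB.
have yA := clique_part_heavy ge px volE (ltW ml) lpos eAB' AB8.
have xh : exists v, 1 <= x v ^+ 2 * h%:R.
  have [/existsP//|] := boolP [exists v, 1 <= x v ^+ 2 * h%:R].
  rewrite negb_exists => /forallP small; exfalso.
  have h4kR : 4 * k%:R <= h%:R :> R by rewrite -natrM ler_nat.
  have hR : 0 < h%:R :> R by rewrite ltr0n.
  have : (\sum_(p in A) x p ^+ 2) * h%:R < k%:R.
    rewrite -cA -(@sum1r_card R _ [in A]) mulr_suml.
    apply: ltr_sum => [|p _]; last by rewrite ltNge small.
    by apply/hasP; have /card_gt0P[p pA] : (0 < #|A|)%N; rewrite ?cA //; exists p;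
      rewrite ?mem_index_enum.
  have : 1 / 4 * h%:R <= (\sum_(p in A) x p ^+ 2) * h%:R by rewrite ler_pM2r.
  lra.
have mm : (m1 <= m)%N by apply: leq_trans mm1; rewrite leq_pmull.
have [A2 [B2 [X2 [d2 [[cA2 clq2 _] [X20 d20 d2k] xX2 xA2 [xT2 _ _]]]]]] :=
  atoms m mm R V e l x ge Ff px volE l0 lk xh.
apply: (extremal_is_split ge px X20 xX2 xA2 xT2 d20 d2k k2 cA2 clq2 volE _ lpos Sl).
apply: leq_trans mk1000; apply: leq_trans (leq_pmull _ _) => //.
have : (2 * 'C(k, 2) = k * k.-1)%N by rewrite -mul_bin_diag bin1.
by rewrite expnS expn1; clear -k2; nia.
Qed.

Theorem theorem1p11 (k t : nat) :
  (2 <= k)%N -> (k <= t)%N ->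
  exists m0 : nat, forall m : nat, (m0 <= m)%N ->
  forall (R : realType) (V : finType) (e : rel V),
    simple_graph e ->
    #|edges e| = m ->
    F_free (@Kplus_rel k t) e ->
    (spec_rad R e <= spec_rad R (@S_rel k m))%R /\
    (spec_rad R e = spec_rad R (@S_rel k m) <-> same_graph e (@S_rel k m)).
Proof.
move=> k2 _; have [m0 ext] := @extremal_same_graph k t k2.
(* The successor forces an edge, hence a vertex [v0]. *)
exists m0.+1 => m m0m R V e ge em Ff.
have {}ext := ext m (ltnW m0m) R V e ge em Ff.
have [v0 _] : exists v0 : V, True.
  have /card_gt0P[E] : (0 < #|edges e|)%N by rewrite em; apply: leq_ltn_trans m0m.
  by rewrite inE => /existsP[v _]; exists v.
have same := same_graph_spec_rad R v0 (inr tt) ge (S_rel_simple k m).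
split; last by split => [E|/same //]; apply: ext; rewrite E.
rewrite leNgt; apply/negP => lt; have := same (ext (ltW lt)) => E.
by rewrite E ltxx in lt.
Qed.
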